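(* There exists a positive constant $C_3$, independent of $n,N,M,\kappa$, such that the following holds. Let $n,N\in\mathbb{N}$ ($n,N\ge 1$), $M>1$, let $f_j\in\mathcal{R}_M$ for $j=1,2$, and let $u_j$ be the radiated random field corresponding to $f_j$, that is, $$u_j(x,\kappa)=\int_0^1 \frac{e^{\mathrm{i}\kappa|x-y|}}{2\mathrm{i}\kappa}f_j(y)\,\mathrm{d}y+\int_0^1\frac{e^{\mathrm{i}\kappa|x-y|}}{2\mathrm{i}\kappa}\sigma_j(y)\,\mathrm{d}W_y .$$ Let $v(x,\kappa)=\mathbf{E}u_1(x,\kappa)-\mathbf{E}u_2(x,\kappa)$ and suppose $$\epsilon_3=\left(\sum_{j=1}^N(2j\pi)^2|\mathrm{Re}\,v(0,j\pi)|^2\right)^{1/2},\qquad \epsilon_4=\sup_{\kappa\in(0,1)}2\kappa|\mathrm{Re}\,v(0,\kappa)|<1 .$$ Then $$\|f_1-f_2\|^2_{L^2(0,1)}\le C_3\left(\epsilon_3^2+\frac{M^2}{\left(\frac{N^{5/8}|\ln\epsilon_4|^{1/9}}{(6n-3)^3}\right)^{2n-1}}\right).$$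
   Context: The random field $u(x,\kappa)$ given by the formula in the claim is the pathwise solution of the one-dimensional stochastic Helmholtz equation $u''+\kappa^2u=f+\sigma\dot W_x$ on $(0,1)$ with outgoing wave conditions $u'(0,\kappa)+\mathrm{i}\kappa u(0,\kappa)=0$, $u'(1,\kappa)-\mathrm{i}\kappa u(1,\kappa)=0$, where $\kappa>0$ is the wavenumber. Here $W$ is a one-dimensional Brownian motion on $[0,1]$ defined on a complete probability space, the second integral is an Itô integral, and $\sigma_j$ are deterministic square-integrable functions on $(0,1)$. $\mathbf{E}$ is expectation. For $n\in\mathbb{N}$ and $M>1$, $$\mathcal{R}_M=\{f\in H^n(0,1):\ \|f\|_{H^n(0,1)}\le M,\ \operatorname{supp}f\subseteq(0,1),\ f:(0,1)\to\mathbb{R}\},$$ where supports are compact subsets of $(0,1)$. Convention: for $\epsilon_4=0$ the second term on the right-hand side is read as $0$ (as $|\ln 0|=\infty$). *)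

(* Defs.v *)
From HB Require Import structures.
From mathcomp Require Import all_boot all_order all_algebra.
From mathcomp Require Import complex.
From mathcomp Require Import all_classical all_reals all_analysis.

Set Implicit Arguments.
Unset Strict Implicit.
Unset Printing Implicit Defensive.

Import Order.TTheory GRing.Theory Num.Theory.
Import numFieldNormedType.Exports.

Local Open Scope classical_set_scope.
Local Open Scope ring_scope.

(* Classes of functions on (0,1) modulo null sets are handled through Borel
   representatives f : R -> R; values outside (0,1) are never used. *)

Section FunctionSpaces.
Context {R : realType}.
Implicit Types (f g phi : R -> R) (n k : nat).

Local Notation mu := (@lebesgue_measure R).

Definition sq_integrable f : Prop :=
  measurable_fun (`]0, 1[%classic : set R) f /\
  mu.-integrable `]0, 1[ (fun x => (f x ^+ 2)%:E).

Definition L2norm f : R := Num.sqrt (\int[mu]_(x in `]0, 1[) (f x ^+ 2)).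

(* C_c^\infty(0,1), the support being the closure taken in R *)
Definition test_function phi : Prop :=
  (forall k x, derivable (derive1n k phi) x 1) /\
  closure [set x | phi x != 0] `<=` `]0, 1[.

Definition is_weak_derivative k f g : Prop :=
  forall phi, test_function phi ->
    \int[mu]_(x in `]0, 1[) (f x * derive1n k phi x) =
    (-1) ^+ k * \int[mu]_(x in `]0, 1[) (g x * phi x).

(* [get] selects a representative: weak derivatives are unique a.e. *)
Definition weak_derivative k f : R -> R :=
  get [set g | sq_integrable g /\ is_weak_derivative k f g].

Definition in_sobolev n f : Prop :=
  sq_integrable f /\
  forall k, (k <= n)%N ->
    exists g, sq_integrable g /\ is_weak_derivative k f g.

Definition sobolev_norm n f : R :=
  Num.sqrt (\sum_(k < n.+1) L2norm (weak_derivative k f) ^+ 2).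

(* Support of the class of f: the complement in R of the largest open set on
   which f, extended by 0 outside (0,1), vanishes a.e. *)
Definition ess_support f : set R :=
  [set x | forall e : R, 0 < e ->
    ~ {ae mu, forall y, y \in `]0, 1[ -> `|y - x| < e -> f y = 0}].

Definition source_class n (M : R) f : Prop :=
  [/\ in_sobolev n f, sobolev_norm n f <= M,
      compact (ess_support f) & ess_support f `<=` `]0, 1[].

End FunctionSpaces.

Section Brownian.
Context {R : realType} {d : measure_display} {T : measurableType d}.
Variables (P : probability T R) (W : R -> T -> R).

Local Notation mu := (@lebesgue_measure R).

Definition increment (s t : R) (w : T) : R := W t w - W s w.

Definition brownian_motion : Prop :=
  [/\ forall t : R, t \in `[0, 1] -> measurable_fun [set: T] (W t),
      {ae P, forall w, W 0 w = 0},
      (forall (m : nat) (t : nat -> R) (A : nat -> set R),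
         0 <= t 0%N -> t m <= 1 ->
         (forall i, (i < m)%N -> t i < t i.+1) ->
         (forall i, measurable (A i)) ->
         P (\bigcap_(i < m) (increment (t i) (t i.+1) @^-1` A i)) =
         (\prod_(i < m) P (increment (t i) (t i.+1) @^-1` A i))%E),
      (forall (s t : R) (A : set R), 0 <= s -> s < t -> t <= 1 -> measurable A ->
         P (increment s t @^-1` A) = normal_prob 0 (Num.sqrt (t - s)) A)
    & {ae P, forall w, {within `[0, 1], continuous (W ^~ w)}}].

(* deterministic elementary integrand  sum_(i < m) c_i 1_(t_i, t_(i+1)] *)
Record step_integrand := StepIntegrand {
  step_size : nat;
  step_pt : nat -> R;
  step_coef : nat -> R;
  step_pt0 : step_pt 0 = 0;
  step_pt1 : step_pt step_size = 1;
  step_pt_le : forall i, (i < step_size)%N -> step_pt i <= step_pt i.+1 }.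

Definition step_fun (s : step_integrand) (y : R) : R :=
  \sum_(i < step_size s)
    step_coef s i * \1_(`]step_pt s i, step_pt s i.+1]%classic : set R) y.

Definition step_ito (s : step_integrand) (w : T) : R :=
  \sum_(i < step_size s)
    step_coef s i * increment (step_pt s i) (step_pt s i.+1) w.

(* I is a version of the Ito integral of the deterministic integrand g: the
   L^2(P)-limit of elementary integrals along an approximation of g in
   L^2(0,1); by the Ito isometry it exists, and is unique P-a.s. *)
Definition is_ito_integral (g : R -> R) (I : T -> R) : Prop :=
  [/\ sq_integrable g, measurable_fun [set: T] I &
    exists s : nat -> step_integrand,
      (\int[mu]_(y in `]0%R, 1%R[) ((g y - step_fun (s k) y) ^+ 2)%:E
         @[k --> \oo] --> 0)%E /\
      (\int[P]_w ((I w - step_ito (s k) w) ^+ 2)%:E @[k --> \oo] --> 0)%E].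

Definition is_cito_integral (g : R -> R[i]) (I : T -> R[i]) : Prop :=
  is_ito_integral (fun y => complex.Re (g y)) (fun w => complex.Re (I w)) /\
  is_ito_integral (fun y => complex.Im (g y)) (fun w => complex.Im (I w)).

Definition cexpectation (X : T -> R[i]) : R[i] :=
  Complex (fine 'E_P[fun w => complex.Re (X w)]%E)
          (fine 'E_P[fun w => complex.Im (X w)]%E).

End Brownian.

Section Helmholtz.
Context {R : realType}.
Local Open Scope complex_scope.

Local Notation mu := (@lebesgue_measure R).

Definition cintegral (g : R -> R[i]) : R[i] :=
  Complex (\int[mu]_(y in `]0, 1[) complex.Re (g y))
          (\int[mu]_(y in `]0, 1[) complex.Im (g y)).

Definition expi (t : R) : R[i] := cos t +i* sin t.

Definition green (kappa x y : R) : R[i] :=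
  expi (kappa * `|x - y|) / (2 * 'i * kappa%:C).

(* Both sides are required to agree for every w: the Ito integral is only
   defined up to a.s. equality, and on a complete probability space this
   covers every field satisfying the formula almost surely. *)
Definition radiated_field (d : measure_display) (T : measurableType d)
    (P : probability T R) (W : R -> T -> R) (f sigma : R -> R)
    (u : R -> R -> T -> R[i]) : Prop :=
  forall x kappa : R, x \in `[0, 1] -> 0 < kappa ->
    exists I : T -> R[i],
      is_cito_integral P W (fun y => green kappa x y * (sigma y)%:C) I /\
      forall w, u x kappa w =
        cintegral (fun y => green kappa x y * (f y)%:C) + I w.

Definition eps3 (v : R -> R -> R[i]) (N : nat) : R :=
  Num.sqrt (\sum_(1 <= j < N.+1)
    (2 * j%:R * pi) ^+ 2 * `|complex.Re (v 0 (j%:R * pi))| ^+ 2).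

Definition eps4 (v : R -> R -> R[i]) : R :=
  sup [set 2 * k * `|complex.Re (v 0 k)| | k in `]0, 1[].

End Helmholtz.

(* Main.v *)
(* Put f = f1 - f2 and S(k) = \int_0^1 f(y) sin(k y) dy.  The Ito integrals have
   mean zero, so 2 k Re v(0,k) = S(k): eps3 collects the first N sine
   coefficients S(j pi), and eps4 is the supremum of |S| on (0,1).  The sines
   are complete in L^2(0,1), hence |f|^2 = 2 \sum_j S(j pi)^2, and the weak
   derivative of order n gives |S(j pi)| <= 2 M / j^n, which controls the tail.
   The coefficients with N < j <= K are recovered from S on (0,1) without
   complex analysis: Lagrange extrapolation of k |-> sin(k y) from O(K) nodes
   in (0,1) has error O(exp(-K)) uniformly in y, and weights of total size
   exp(O(K^2)), which eps4 <= exp(-K^3) absorbs.  If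
   X = N^(5/8) |ln eps4|^(1/9) exceeds N, then X^3 <= |ln eps4|, so K can be
   taken to be the integer part of X; otherwise K = N suffices. *)

Require Import Defs.
From mathcomp Require Import all_boot all_order all_algebra.
From mathcomp Require Import complex.
From mathcomp Require Import all_classical all_reals all_analysis.
From mathcomp Require Import measurable_realfun.
From mathcomp Require Import ring lra.
Import Order.TTheory GRing.Theory Num.Theory.
Import numFieldNormedType.Exports.
Local Open Scope classical_set_scope.
Local Open Scope ring_scope.
Set Implicit Arguments.
Unset Strict Implicit.
Unset Printing Implicit Defensive.

(** The constant may not depend on [n], so every loss growing with [n] must be paid by the factor (6
    n - 3)^(3 (2 n - 1)). With p = 2 n - 1 these losses are the (p + 1)! that converts exp(-K) into
    K^(-p) and the 2^p lost when X is rounded down to K; everything else is numerical. The Lagrange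
    weights cost exp(1200 K^2), and the cube in eps4 <= exp(-K^3) bounds their product with eps4
    uniformly in K, leaving even a spare factor exp(-K). A sine is not a test function, so a weak
    derivative cannot be tested against it directly. Compact support in (0,1) keeps f away from the
    endpoints, and multiplying the sine by a smooth cutoff equal to 1 where f lives repairs this.
    The same margin makes completeness elementary: f / sin(pi y) is still square integrable, and
    sin(pi y) times a polynomial in cos(pi y) is a finite combination of sines. *)

(** * Square-integrable functions on a set of measure one *)

Section SquareIntegrable.
Context d (T : measurableType d) (R : realType) (mu : {measure set T -> \bar R}).
Variable D : set T.
Hypotheses (mD : measurable D) (muD : mu D = 1%E).
Implicit Types f g phi : T -> R.

Local Notation intg f := (mu.-integrable D (EFin \o f)).
Local Notation "'Int' f" := (\int[mu]_(x in D) f x) (at level 10, f at level 8).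

Let finD : (mu D < +oo)%E. Proof. by rewrite muD ltry. Qed.

(** The set [D] of measure one stands for (0,1) with Lebesgue measure and for a probability space
    alike; in the first case [L2] unfolds to [sq_integrable]. *)
Definition L2 f := measurable_fun D f /\ intg (fun x => f x ^+ 2).

Lemma integrable_le f g : measurable_fun D f ->
  (forall x, D x -> `|f x| <= g x) -> intg g -> intg f.
Proof.
move=> mf fg; apply: le_integrable => //; first exact/measurable_EFinP.
by move=> x Dx /=; rewrite lee_fin (le_trans (fg x Dx)) // ler_norm.
Qed.

Lemma integrable_bounded_measurable phi (c : R) : measurable_fun D phi ->
  (forall x, D x -> `|phi x| <= c) -> intg phi.
Proof.
move=> mphi phic; apply: measurable_bounded_integrable => //.
exists c; split; first exact: num_real.
by move=> y cy x Dx /=; rewrite (le_trans (phic x Dx)) // ltW.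
Qed.

Lemma L2_integrable f : L2 f -> intg f.
Proof.
case=> mf f2; have i1 : intg (fun=> 1) by apply: (@integrable_bounded_measurable _ 1) => // x _; rewrite normr1.
apply: (@integrable_le _ (fun x => 1 + f x ^+ 2)) => //.
  move=> x _; have := sqr_ge0 (`|f x| - 1); rewrite sqrrB real_normK ?num_real // => h.
  have := normr_ge0 (f x); nra.
exact: (integrableD mD i1 f2).
Qed.

Lemma L2M f g : L2 f -> L2 g -> intg (fun x => f x * g x).
Proof.
case=> mf f2 [mg g2]; apply: (@integrable_le _ (fun x => f x ^+ 2 + g x ^+ 2)).
- exact: measurable_funM.
- move=> x _; rewrite normrM -(real_normK (num_real (f x))) -(real_normK (num_real (g x))).
  have := sqr_ge0 (`|f x| - `|g x|); have := normr_ge0 (f x); have := normr_ge0 (g x); nra.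
- exact: (integrableD mD f2 g2).
Qed.

Lemma L2_bounded phi (c : R) : measurable_fun D phi ->
  (forall x, D x -> `|phi x| <= c) -> L2 phi.
Proof.
move=> mphi phic; split=> //; apply: (@integrable_bounded_measurable _ (c ^+ 2)).
  exact: measurable_funX.
move=> x Dx; rewrite normrX lerXn2r ?nnegrE ?phic //.
exact: le_trans (phic x Dx).
Qed.

Lemma L2_mulr f phi (c : R) : L2 f -> measurable_fun D phi ->
  (forall x, D x -> `|phi x| <= c) -> L2 (fun x => f x * phi x).
Proof.
case=> mf f2 mphi phic; split; first exact: measurable_funM.
apply: (@integrable_le _ (fun x => c ^+ 2 * f x ^+ 2)).
- by apply: measurable_funX; exact: measurable_funM.
- move=> x Dx; rewrite ger0_norm ?sqr_ge0 // exprMn mulrC ler_wpM2r ?sqr_ge0 //.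
  rewrite -(real_normK (num_real (phi x))) lerXn2r ?nnegrE ?phic //.
  exact: le_trans (phic x Dx).
- exact: (integrableZl mD (c ^+ 2) f2).
Qed.

Lemma L2Z (c : R) f : L2 f -> L2 (fun x => c * f x).
Proof.
move=> Lf; have : L2 (fun x => f x * c) by exact: (@L2_mulr _ (cst c) `|c| Lf).
by under eq_fun do rewrite mulrC.
Qed.

Lemma L2D f g : L2 f -> L2 g -> L2 (fun x => f x + g x).
Proof.
move=> Lf Lg; split; first by case: Lf Lg => mf _ [mg _]; exact: measurable_funD.
have := integrableD mD (integrableD mD Lf.2 Lg.2) (integrableZl mD 2 (L2M Lf Lg)).
by apply: eq_integrable => // x _ /=; congr EFin; ring.
Qed.

Lemma L2B f g : L2 f -> L2 g -> L2 (fun x => f x - g x).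
Proof.
move=> Lf Lg; have := L2D Lf (L2Z (-1) Lg).
by under eq_fun do rewrite mulN1r.
Qed.

Lemma L2_sum I (s : seq I) (h : I -> T -> R) :
  (forall i, L2 (h i)) -> L2 (fun x => \sum_(i <- s) h i x).
Proof.
move=> Lh; elim: s => [|i s ih].
  under eq_fun do rewrite big_nil.
  by apply: (@L2_bounded _ 0) => // x _; rewrite normr0.
by under eq_fun do rewrite big_cons; exact: L2D.
Qed.

Lemma Rintegral_sum I (s : seq I) (h : I -> T -> R) :
  (forall i, intg (h i)) ->
  Int (fun x => \sum_(i <- s) h i x) = \sum_(i <- s) Int (h i).
Proof.
move=> ih; have is_ s' : intg (fun x => \sum_(i <- s') h i x).
  have := @integrable_sum _ _ _ mu D mD I s' xpredT (fun i x => (h i x)%:E) (fun i _ => ih i).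
  by apply: eq_integrable => // x _ /=; rewrite sumEFin.
elim: s => [|i s IH].
  by under eq_Rintegral do rewrite big_nil; rewrite big_nil Rintegral_cst // mul0r.
by under eq_Rintegral do rewrite big_cons; rewrite big_cons RintegralD // IH.
Qed.

(** Expand the integral of (|g| - t)^2 >= 0, where t is the mean of |g|; measure one makes the
    constant t^2 integrate to itself. *)
Lemma sqr_Rintegral_norm_le g : L2 g -> (Int (fun x => `|g x|)) ^+ 2 <= Int (fun x => g x ^+ 2).
Proof.
move=> Lg; set t := Int (fun x => `|g x|).
have ing : intg (fun x => `|g x|) by exact: integrable_norm (L2_integrable Lg).
have i1 : intg (fun=> t ^+ 2).
  by apply: (@integrable_bounded_measurable _ (t ^+ 2)) => // x _; rewrite ger0_norm ?sqr_ge0.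
have: 0 <= Int (fun x => (g x ^+ 2 - (2 * t) * `|g x|) + t ^+ 2).
  apply: Rintegral_ge0 => x _; have := sqr_ge0 (`|g x| - t).
  by rewrite sqrrB real_normK ?num_real //; congr (_ <= _); ring.
rewrite RintegralD //; last first.
  exact: (integrableB mD Lg.2 (integrableZl mD (2 * t) ing)).
rewrite RintegralB //; [|exact: Lg.2|exact: (integrableZl mD (2 * t) ing)].
rewrite RintegralZl // Rintegral_cst // -/t.
have -> : fine (mu D) = 1 by rewrite muD.
lra.
Qed.

Lemma normr_RintegralM_le g phi (c M : R) : L2 g -> measurable_fun D phi ->
  (forall x, D x -> `|phi x| <= c) -> 0 <= M -> Int (fun x => g x ^+ 2) <= M ^+ 2 ->
  `|Int (fun x => g x * phi x)| <= M * c.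
Proof.
move=> Lg mphi phic M0 gM.
have ing := integrable_norm (L2_integrable Lg).
apply: (le_trans (le_normr_Rintegral mD (L2_integrable (L2_mulr Lg mphi phic)))).
(* A set of measure one is inhabited, and [c] dominates an absolute value at any of its points. *)
have c0 : 0 <= c.
  have [[x Dx]|D0] := pselect (exists x, D x); first exact: le_trans (phic x Dx).
  have : D = set0 by rewrite -subset0 => x Dx; case: D0; exists x.
  by move=> De; move: muD; rewrite De measure0 => /esym/eqP; rewrite onee_eq0.
have : Int (fun x => `|g x * phi x|) <= Int (fun x => c * `|g x|).
  apply: le_Rintegral => //.
  - exact: integrable_norm (L2_integrable (L2_mulr Lg mphi phic)).
  - exact: (integrableZl mD c ing).
  - by move=> x Dx; rewrite normrM mulrC ler_wpM2r ?phic.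
move=> /le_trans; apply; rewrite RintegralZl // mulrC ler_wpM2r //.
rewrite -(@ler_pXn2r _ 2%N) ?nnegrE //; last by apply: Rintegral_ge0.
exact: le_trans (sqr_Rintegral_norm_le Lg) gM.
Qed.

End SquareIntegrable.

(** * Completeness of the sine system *)

Section Bernstein.
Context {R : realType}.
Implicit Types (t c eta C x y : R) (m k : nat) (phi : nat -> R).

(* [\sum_(k <= m) phi k * 'C(m, k) * t ^+ k * (1 - t) ^+ (m - k)], given by
   Pascal's recurrence *)
Fixpoint bernstein m t phi : R :=
  if m is m'.+1 then
    (1 - t) * bernstein m' t phi + t * bernstein m' t (phi \o succn)
  else phi 0%N.

(** The right-hand side is the mean of the parabola a + b (k - z)^2 under the binomial law with
    parameters m and t: variance m t (1 - t), squared bias (m t - z)^2. The centre [z] is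
    universally quantified because Pascal's recurrence shifts the sequence, hence [z], by one. *)
Lemma bernstein_dist_le m t phi c a b z : 0 <= t <= 1 ->
  (forall k, (k <= m)%N -> `|phi k - c| <= a + b * (k%:R - z) ^+ 2) ->
  `|bernstein m t phi - c| <=
    a + b * (m%:R * (t * (1 - t)) + (m%:R * t - z) ^+ 2).
Proof.
move=> /andP[t0 t1]; elim: m phi z => [|m IH] phi z H.
  by rewrite /= !mul0r add0r; exact: (H 0%N).
have h0 := IH phi z (fun k km => H k (leqW km)).
have h1 : `|bernstein m t (phi \o succn) - c| <=
    a + b * (m%:R * (t * (1 - t)) + (m%:R * t - (z - 1)) ^+ 2).
  apply: IH => k km; have -> : k%:R - (z - 1) = k.+1%:R - z :> R.
    by rewrite -[k.+1]addn1 natrD; ring.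
  exact: H.
have -> : bernstein m.+1 t phi - c = (1 - t) * (bernstein m t phi - c)
    + t * (bernstein m t (phi \o succn) - c) by rewrite /=; ring.
apply: (le_trans (ler_normD _ _)); rewrite !normrM (ger0_norm t0) ger0_norm ?subr_ge0 //.
apply: (le_trans (lerD (ler_wpM2l _ h0) (ler_wpM2l t0 h1))); rewrite ?subr_ge0 //.
rewrite -[m.+1]addn1 natrD le_eqVlt; apply/orP; left; apply/eqP; ring.
Qed.

(** This coordinate maps [0,1] bijectively onto itself, so polynomials in it approximate continuous
    functions; multiplied by sin(pi x) they become combinations of sines. *)
Definition cos01 x : R := (1 + cos (pi * x)) / 2.

Lemma cos01_bounds x : 0 <= cos01 x <= 1.
Proof.
by rewrite /cos01; have := cos_geN1 (pi * x); have := cos_le1 (pi * x); move=> ? ?; apply/andP; split; lra.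
Qed.

Lemma cos01_inj x y : 0 <= x <= 1 -> 0 <= y <= 1 -> cos01 x = cos01 y -> x = y.
Proof.
move=> /andP[x0 x1] /andP[y0 y1] h; apply: (mulfI (lt0r_neq0 (pi_gt0 R))).
apply: cos_inj; rewrite ?in_itv /= ?mulr_ge0 ?pi_ge0 ?ler_piMr ?pi_ge0 //.
by move: h; rewrite /cos01; lra.
Qed.

Lemma cos01_surj t : 0 <= t <= 1 -> exists2 x, 0 <= x <= 1 & cos01 x = t.
Proof.
move=> /andP[t0 t1]; have h : -1 <= 2 * t - 1 <= 1 by apply/andP; split; lra.
exists (acos (2 * t - 1) / pi).
  by rewrite divr_ge0 ?acos_ge0 ?pi_ge0 //= ler_pdivrMr ?pi_gt0 // mul1r acos_lepi.
rewrite /cos01 [pi * _]mulrC divfK ?gt_eqF ?pi_gt0 // acosK ?in_itv //=; lra.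
Qed.

Lemma cos01_continuous : continuous cos01.
Proof.
move=> x; apply: cvgMr_tmp; apply: cvgD; first exact: cvg_cst.
apply: continuous_comp; last exact: continuous_cos.
by apply: cvgMl_tmp; exact: cvg_id.
Qed.

(** On the compact set where |q x - q y| >= eta the two points are distinct, so the squared [cos01]
    distance has a positive minimum there; [C] is the maximum of |q x - q y| over that minimum, and
    0 if the set is empty. *)
Lemma continuous_dist_cos01 (q : R -> R) eta : continuous q -> 0 < eta ->
  exists2 C : R, 0 <= C & forall x y, 0 <= x <= 1 -> 0 <= y <= 1 ->
    `|q x - q y| <= eta + C * (cos01 x - cos01 y) ^+ 2.
Proof.
move=> cq eta0.
pose F (z : R * R) := `|q z.1 - q z.2|.
pose G (z : R * R) := (cos01 z.1 - cos01 z.2) ^+ 2.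
have cF : continuous F.
  move=> z; apply: cvg_norm; apply: cvgB.
    by apply: (@continuous_comp _ _ _ fst q); [exact: cvg_fst|exact: cq].
  by apply: (@continuous_comp _ _ _ snd q); [exact: cvg_snd|exact: cq].
have cG : continuous G.
  move=> z; apply: (@continuous_comp _ _ _ (fun z => cos01 z.1 - cos01 z.2) (fun u => u ^+ 2)).
    apply: cvgB.
      by apply: (@continuous_comp _ _ _ fst cos01); [exact: cvg_fst|exact: cos01_continuous].
    by apply: (@continuous_comp _ _ _ snd cos01); [exact: cvg_snd|exact: cos01_continuous].
  exact: exprn_continuous.
pose Q := (`[0, 1]%classic `*` `[0, 1]%classic : set (R * R)).
have cQ : compact Q by apply: compact_setX; exact: segment_compact.
pose A := Q `&` [set z | eta <= F z].
have cA : compact A.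
  apply: compact_closedI => //.
  by apply: (preimage_closed _ (@closed_ge _ eta)) => z _; exact: cF.
have [A0|A0] := pselect (A !=set0); last first.
  exists 0 => // x y x01 y01; rewrite mul0r addr0 leNgt; apply/negP => h.
  by apply: A0; exists (x, y); split; [split; rewrite /= in_itv|exact: ltW].
have [z1 /set_mem zA minG] := compact_EVT_min A0 cA (continuous_subspaceT cG).
have [z2 _ maxF] := compact_EVT_max A0 cA (continuous_subspaceT cF).
have Gpos : 0 < G z1.
  rewrite lt_neqAle sqr_ge0 andbT eq_sym; apply/negP; rewrite sqrf_eq0 subr_eq0 => /eqP e.
  case: zA => -[/=]; rewrite !in_itv /= => h1 h2; rewrite /F (cos01_inj h1 h2 e) subrr normr0.
  by rewrite leNgt eta0.
have FG0 : 0 <= F z2 / G z1 by apply: divr_ge0; [exact: normr_ge0|exact: ltW].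
exists (F z2 / G z1) => //.
move=> x y x01 y01; have [h|h] := leP (F (x, y)) eta.
  by rewrite (le_trans h) // lerDl mulr_ge0 ?sqr_ge0.
have xyA : (x, y) \in A by rewrite inE; split; [split; rewrite /= in_itv|exact: ltW].
rewrite -[leLHS]add0r lerD ?(ltW eta0) //.
apply: (le_trans (maxF _ xyA)); rewrite mulrAC ler_pdivlMr //.
by apply: ler_wpM2l; [exact: normr_ge0|exact: (minG _ xyA)].
Qed.

Lemma bernstein_cos01_approx (q : R -> R) eta : continuous q -> 0 < eta ->
  exists m phi, forall x, 0 <= x <= 1 ->
    `|bernstein m (cos01 x) phi - q x| <= eta.
Proof.
move=> cq eta0; have eta2 : 0 < eta / 2 by rewrite divr_gt0.
have [C C0 HC] := continuous_dist_cos01 cq eta2.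
(* Sample points: preimages under [cos01] of the equidistant points k / (m + 1). *)
have nod m k : {y : R | (k <= m.+1)%N -> 0 <= y <= 1 /\ cos01 y = k%:R / m.+1%:R}.
  apply: cid; have [km|km] := boolP (k <= m.+1)%N; last by exists 0.
  have [|y y01 yt] := @cos01_surj (k%:R / m.+1%:R); last by exists y.
  by rewrite divr_ge0 //= ler_pdivrMr // mul1r ler_nat.
(* With the parabola centred at (m + 1) t the bias vanishes, and the variance term C t (1 - t) / (m
   + 1) is at most eta / 2. *)
pose m := Num.truncn (C / eta); have hm : C / eta <= m.+1%:R by rewrite ltW // truncnS_gt.
exists m.+1, (fun k => q (sval (nod m k))) => x x01.
have mp : 0 < m.+1%:R :> R by rewrite ltr0n.
have tb := cos01_bounds x; set t := cos01 x in tb *.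
apply: (le_trans (@bernstein_dist_le _ _ _ _ (eta / 2) (C / m.+1%:R ^+ 2) (m.+1%:R * t) tb _)).
  move=> k km; have [y01 yt] := svalP (nod m k) km.
  apply: (le_trans (HC _ _ y01 x01)); rewrite yt lerD2l -/t.
  by rewrite le_eqVlt; apply/orP; left; apply/eqP; field; rewrite gt_eqF.
have -> : C / m.+1%:R ^+ 2 * (m.+1%:R * (t * (1 - t)) + (m.+1%:R * t - m.+1%:R * t) ^+ 2)
    = C / m.+1%:R * (t * (1 - t)) by field; rewrite gt_eqF.
have Cm : C / m.+1%:R <= eta.
  by rewrite ler_pdivrMr // mulrC -ler_pdivrMr.
have Cm0 : 0 <= C / m.+1%:R by rewrite divr_ge0 // ltW.
case/andP: tb => t0 t1.
have tt : t * (1 - t) <= 1 / 2 by have := sqr_ge0 (t - 1/2); nra.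
have tt0 : 0 <= t * (1 - t) by rewrite mulr_ge0 ?subr_ge0.
have := ler_pM Cm0 tt0 Cm tt; move: (C / _) (t * _) => c u; lra.
Qed.

End Bernstein.

(** * Finite combinations of sines *)

Section SinePolynomials.
Context {R : realType}.
Implicit Types (j K : nat) (x : R) (f T : R -> R) (a : nat -> R).

Definition sinpi j x : R := sin (j%:R * pi * x).

(** One coefficient sequence represents T for every large K, so that two combinations can be brought
    to a common length and the length can be increased freely. *)
Definition sine_poly T := exists K0 a, forall K, (K0 <= K)%N ->
  forall x, T x = \sum_(j < K) a j * sinpi j x.

Lemma sine_poly_sinpi j : sine_poly (sinpi j).
Proof.
exists j.+1, (fun i => (i == j)%:R) => K jK x.
rewrite (bigD1 (Ordinal jK)) //= eqxx mul1r big1 ?addr0 // => i ij.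
by rewrite -(inj_eq val_inj) /= in ij; rewrite (negbTE ij) mul0r.
Qed.

Lemma sine_polyD T1 T2 : sine_poly T1 -> sine_poly T2 ->
  sine_poly (fun x => T1 x + T2 x).
Proof.
move=> [K1 [a1 h1]] [K2 [a2 h2]]; exists (maxn K1 K2), (fun j => a1 j + a2 j) => K.
rewrite geq_max => /andP[k1 k2] x; rewrite (h1 _ k1) (h2 _ k2) -big_split /=.
by apply: eq_bigr => j _; rewrite mulrDl.
Qed.

Lemma sine_polyZ c T : sine_poly T -> sine_poly (fun x => c * T x).
Proof.
move=> [K0 [a h]]; exists K0, (fun j => c * a j) => K k0 x.
by rewrite (h _ k0) mulr_sumr; apply: eq_bigr => j _; rewrite mulrA.
Qed.

Lemma eq_sine_poly T1 T2 : T1 =1 T2 -> sine_poly T1 -> sine_poly T2.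
Proof. by move=> e [K0 [a h]]; exists K0, a => K k0 x; rewrite -e; exact: h. Qed.

Lemma sine_poly_sum (n : nat) (F : nat -> R -> R) : (forall j, sine_poly (F j)) ->
  sine_poly (fun x => \sum_(j < n) F j x).
Proof.
move=> hF; elim: n => [|n IH].
  apply: (@eq_sine_poly (fun x => 0 * sinpi 0 x)); first by move=> x; rewrite mul0r big_ord0.
  exact/sine_polyZ/sine_poly_sinpi.
apply: (@eq_sine_poly (fun x => \sum_(j < n) F j x + F n x)).
  by move=> x; rewrite big_ord_recr.
exact: sine_polyD.
Qed.

Lemma sinpi_cos j x : sinpi j.+1 x * cos (pi * x) =
  1 / 2 * sinpi j.+2 x + 1 / 2 * sinpi j x.
Proof.
rewrite /sinpi.
have -> : j.+2%:R * pi * x = j.+1%:R * pi * x + pi * x by rewrite -[j.+2]addn1 natrD; ring.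
have -> : j%:R * pi * x = j.+1%:R * pi * x - pi * x by rewrite -[j.+1]addn1 natrD; ring.
by rewrite sinD sinB; field.
Qed.

Lemma sine_poly_mul_cos T : sine_poly T -> sine_poly (fun x => T x * cos (pi * x)).
Proof.
move=> [K0 [a h]].
pose F j x := a j * (sinpi j x * cos (pi * x)).
apply: (@eq_sine_poly (fun x => \sum_(j < K0) F j x)).
  by move=> x; rewrite (h _ (leqnn _)) mulr_suml; apply: eq_bigr => j _; rewrite -mulrA.
(* The term j = 0 is zero; it is split off because the product formula lowers the index by one. *)
apply: sine_poly_sum => -[|j].
  apply: (@eq_sine_poly (fun x => 0 * sinpi 0 x)); last exact/sine_polyZ/sine_poly_sinpi.
  by move=> x; rewrite /F /sinpi !mul0r sin0 mul0r mulr0.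
apply: (@eq_sine_poly (fun x => a j.+1 * (1 / 2 * sinpi j.+2 x + 1 / 2 * sinpi j x))).
  by move=> x; rewrite /F sinpi_cos.
by apply: sine_polyZ; apply: sine_polyD; apply/sine_polyZ/sine_poly_sinpi.
Qed.

Lemma sine_poly_mul_cos01 T : sine_poly T -> sine_poly (fun x => T x * cos01 x).
Proof.
move=> sT; apply: (@eq_sine_poly (fun x => 1 / 2 * T x + 1 / 2 * (T x * cos (pi * x)))).
  by move=> x; rewrite /cos01; field.
by apply: sine_polyD; apply: sine_polyZ => //; exact: sine_poly_mul_cos.
Qed.

Lemma sine_poly_bernstein m phi :
  sine_poly (fun x => sin (pi * x) * bernstein m (cos01 x) phi).
Proof.
elim: m phi => [|m IH] phi /=.
  apply: (@eq_sine_poly (fun x => phi 0%N * sinpi 1 x)).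
    by move=> x; rewrite /sinpi mul1r mulrC.
  exact/sine_polyZ/sine_poly_sinpi.
pose A x := sin (pi * x) * bernstein m (cos01 x) phi.
pose B x := sin (pi * x) * bernstein m (cos01 x) (phi \o succn).
apply: (@eq_sine_poly (fun x => (A x + (-1) * (A x * cos01 x)) + B x * cos01 x)).
  by move=> x; rewrite /A /B; ring.
apply: sine_polyD; last exact/sine_poly_mul_cos01/IH.
by apply: sine_polyD; [exact: IH|exact/sine_polyZ/sine_poly_mul_cos01/IH].
Qed.

End SinePolynomials.

(** * Orthogonality, density and Parseval's inequality *)

Section Parseval.
Context {R : realType}.
Local Notation mu := (@lebesgue_measure R).
Local Notation D := (`]0, 1[%classic : set R).
Local Notation "'Int' f" := (\int[mu]_(x in `]0, 1[) f x) (at level 10, f at level 8).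
Implicit Types (j K : nat) (x : R) (f T : R -> R) (a : nat -> R).

Lemma measure_unit_itv : mu D = 1%E.
Proof. by rewrite lebesgue_measure_itv /= lte_fin ltr01 oppr0 adde0. Qed.

Lemma measurable_unit_itv : measurable (D : set (measurableTypeR R)).
Proof. exact: measurable_itv. Qed.

Let mD := measurable_unit_itv.
Let muD := measure_unit_itv.

Lemma continuous_L2 f (c : R) : continuous f -> (forall x, `|f x| <= c) -> L2 mu D f.
Proof.
move=> cf fc; apply: (@L2_bounded _ _ _ mu D mD muD f c); last by move=> x _.
by apply: measurable_funTS; exact: continuous_measurable_fun.
Qed.

Lemma continuous_sinl (c : R) : continuous (fun x => sin (c * x)).
Proof.
move=> x; apply: continuous_comp; last exact: continuous_sin.
by apply: cvgMl_tmp; exact: cvg_id.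
Qed.

Lemma continuous_cosl (c : R) : continuous (fun x => cos (c * x)).
Proof.
move=> x; apply: continuous_comp; last exact: continuous_cos.
by apply: cvgMl_tmp; exact: cvg_id.
Qed.

Lemma L2_sinpi j : L2 mu D (sinpi j).
Proof. by apply: (@continuous_L2 _ 1); [exact: continuous_sinl|move=> x; exact: sin_max]. Qed.

Lemma sin_natmul_pi j : sin (j%:R * pi) = 0 :> R.
Proof.
elim: j => [|j IH]; first by rewrite mul0r sin0.
by rewrite -[j.+1]addn1 natrD mulrDl mul1r sinDpi IH oppr0.
Qed.

Lemma Rintegral_cos (c : R) : c != 0 -> sin c = 0 -> Int (fun x => cos (c * x)) = 0.
Proof.
move=> c0 sc.
pose F x : R := sin (c * x) / c.
have dF x : is_derive x 1 F (cos (c * x)).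
  have -> : F = (fun x => c^-1 *: (sin \o (fun y => c *: y)) x) by apply/funext => y; rewrite /F mulrC.
  have h := @is_derive1_comp _ (sin : R -> R) (fun y : R => c *: y) x (cos (c * x)) c.
  have := @is_deriveZ _ _ _ (sin \o (fun y : R => c *: y)) c^-1 x 1 (cos (c * x) * c).
  move=> /(_ _); rewrite /GRing.scale /= mulrCA mulVf // mulr1; apply; apply: h.
  have := @is_deriveZ _ _ _ (@id R) c x 1 1; rewrite /GRing.scale /= mulr1; apply.
have cF : continuous F by move=> x; apply/differentiable_continuous/derivable1_diffP; case: (dF x).
have H : (\int[mu]_(x in `[0%R, 1%R]) (cos (c * x))%:E = (F 1)%:E - (F 0)%:E)%E.
  apply: continuous_FTC2; first exact: ltr01.
  - by apply: continuous_subspaceT; exact: continuous_cosl.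
  - split; first by move=> x _; case: (dF x).
    + by apply: cvg_at_right_filter; exact: cF.
    + by apply: cvg_at_left_filter; exact: cF.
  - by move=> x _; rewrite derive1E; case: (dF x).
have mc (E : set R) : measurable E -> measurable_fun E (fun x => (cos (c * x))%:E).
  by move=> mE; apply/measurable_funTS/measurable_EFinP; apply: continuous_measurable_fun; exact: continuous_cosl.
rewrite /Rintegral integral_itv_bndo_bndc; last exact: mc.
rewrite integral_itv_obnd_cbnd; last exact: mc.
by rewrite H /F mulr1 mulr0 sc sin0 !mul0r subee.
Qed.

Lemma sinpi_orthogonal i j :
  Int (fun x => sinpi i x * sinpi j x) = ((i == j) && (i != 0)%N)%:R / 2.
Proof.
have [->|i0] := eqVneq i 0%N.
  rewrite andbF mul0r /=; under eq_Rintegral do rewrite /sinpi !mul0r sin0 mul0r.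
  by rewrite Rintegral_cst // mul0r.
rewrite andbT.
pose A x := cos ((i%:R - j%:R) * pi * x) : R.
pose B x := cos ((i%:R + j%:R) * pi * x) : R.
have iA : mu.-integrable D (EFin \o A).
  apply: (@L2_integrable _ _ _ mu D mD muD); apply: (@continuous_L2 _ 1); first exact: continuous_cosl.
  by move=> x; exact: cos_max.
have iB : mu.-integrable D (EFin \o B).
  apply: (@L2_integrable _ _ _ mu D mD muD); apply: (@continuous_L2 _ 1); first exact: continuous_cosl.
  by move=> x; exact: cos_max.
have -> : Int (fun x => sinpi i x * sinpi j x) = Int (fun x => 1 / 2 * (A x - B x)).
  apply: eq_Rintegral => x _; rewrite /A /B /sinpi.
  have -> : (i%:R - j%:R) * pi * x = i%:R * pi * x - j%:R * pi * x by ring.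
  have -> : (i%:R + j%:R) * pi * x = i%:R * pi * x + j%:R * pi * x by ring.
  by rewrite cosB cosD; field.
have iAB : mu.-integrable D (EFin \o (fun x => A x - B x)) by exact: (integrableB mD iA iB).
rewrite RintegralZl //.
rewrite RintegralB //.
have sij : sin ((i%:R - j%:R) * pi) = 0 :> R.
  by rewrite mulrBl sinB !sin_natmul_pi mul0r mulr0 subrr.
have -> : Int B = 0.
  apply: Rintegral_cos; last by rewrite -natrD sin_natmul_pi.
  apply: mulf_neq0; last by rewrite gt_eqF ?pi_gt0.
  by rewrite -natrD pnatr_eq0 addn_eq0 negb_and i0.
have [ij|ij] := eqVneq i j.
  rewrite /A ij subrr; under eq_Rintegral do rewrite !mul0r cos0.
  rewrite Rintegral_cst // [fine _](_ : _ = 1) ?subr0 ?mulr1 //.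
  exact: (congr1 fine muD).
rewrite Rintegral_cos // ?subr0 ?mulr0 ?mul0r //.
by apply: mulf_neq0; [rewrite subr_eq0 eqr_nat|rewrite gt_eqF ?pi_gt0].
Qed.

(** By orthogonality the right side minus the left side equals half the sum of (2 S_j - a_j)^2, with
    S_j the pairing of f with the j-th sine. The coefficients [a] are arbitrary, so any
    approximating combination may be inserted. *)
Lemma bessel_best_approximation f a K : L2 mu D f ->
  Int (fun x => f x ^+ 2) <=
    Int (fun x => (f x - \sum_(j < K) a j * sinpi j x) ^+ 2) +
    2 * \sum_(j < K) (Int (fun x => f x * sinpi j x)) ^+ 2.
Proof.
move=> Lf; set T := fun x => \sum_(j < K) a j * sinpi j x.
have LT : L2 mu D T.
  by apply: (@L2_sum _ _ _ mu D mD muD) => j; apply: (L2Z mD); exact: L2_sinpi.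
pose S j := Int (fun x => f x * sinpi j x).
have iT2 : Int (fun x => T x * T x) = \sum_(j < K) a j ^+ 2 * ((j : nat) != 0%N)%:R / 2.
  have -> : Int (fun x => T x * T x) = \sum_(j < K) Int (fun x => T x * (a j * sinpi j x)).
    rewrite -(Rintegral_sum mD) => [|j]; last first.
      by apply: (L2M mD LT); apply: (L2Z mD); exact: L2_sinpi.
    by apply: eq_Rintegral => x _; rewrite mulr_sumr.
  apply: eq_bigr => j _.
  have -> : Int (fun x => T x * (a j * sinpi j x)) =
     \sum_(i < K) a i * a j * Int (fun x => sinpi i x * sinpi j x).
    have iij (i : 'I_K) : mu.-integrable D (EFin \o (fun x => sinpi i x * sinpi j x)).
      exact: (L2M mD (L2_sinpi i) (L2_sinpi j)).
    under [RHS]eq_bigr do rewrite -RintegralZl //.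
    rewrite -(Rintegral_sum mD) => [|i]; last exact: (integrableZl mD (a i * a j) (iij i)).
    by apply: eq_Rintegral => x _; rewrite mulr_suml; apply: eq_bigr => i _; ring.
  rewrite (bigD1 j) //= big1 ?addr0 => [|i ij]; last first.
    by rewrite sinpi_orthogonal (negbTE (_ : val i != val j)) ?mul0r ?mulr0 // (inj_eq val_inj).
  by rewrite sinpi_orthogonal eqxx /= -expr2 mulrA.
have ifT : Int (fun x => f x * T x) = \sum_(j < K) a j * S j.
  have iij (j : 'I_K) : mu.-integrable D (EFin \o (fun x => f x * sinpi j x)).
    exact: (L2M mD Lf (L2_sinpi j)).
  under [RHS]eq_bigr do rewrite /S -RintegralZl //.
  rewrite -(Rintegral_sum mD) => [|i]; last exact: (integrableZl mD (a i) (iij i)).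
  by apply: eq_Rintegral => x _; rewrite mulr_sumr; apply: eq_bigr => i _; ring.
have -> : Int (fun x => (f x - T x) ^+ 2) =
   Int (fun x => f x ^+ 2) - 2 * Int (fun x => f x * T x) + Int (fun x => T x * T x).
  have i1 := Lf.2; have i2 := L2M mD Lf LT; have i3 := L2M mD LT LT.
  have i2' : mu.-integrable D (EFin \o (fun x => 2 * (f x * T x))) by exact: (integrableZl mD 2 i2).
  rewrite -RintegralZl // -RintegralB // -RintegralD //; last exact: (integrableB mD i1 i2').
  by apply: eq_Rintegral => x _; ring.
rewrite ifT iT2; set I2 := Rintegral _ _ _; set X := \sum_(j < K) _; set Y := \sum_(j < K) _; set Z := \sum_(j < K) _.
suff : 0 <= (-2) * X + Y + 2 * Z by move: I2 X Y Z => I2 X Y Z; lra.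
rewrite /X /Y /Z !mulr_sumr -!big_split /=; apply: sumr_ge0 => j _; rewrite -/(S j).
have [->|j0] := eqVneq (j : nat) 0%N.
  have -> : S 0%N = 0.
    rewrite /S; under eq_Rintegral do rewrite /sinpi !mul0r sin0 mulr0.
    by rewrite Rintegral_cst // mul0r.
  by rewrite !mulr0 mul0r expr0n mulr0 !addr0.
have := sqr_ge0 (2 * S j - a j); rewrite ?j0 /= mulr1; move: (S j) (a j) => y z; lra.
Qed.


(** The difference of square roots is the signed square root of [G], inverse to a |-> a |a|, and the
    claim is its Hölder continuity of exponent 1/2. The factor 2 is attained when a^2 = |G| with
    opposite signs. Negative [G] reduces to positive by changing both signs. *)
Lemma signed_sqrt_dist (a G : R) :
  (a - (Num.sqrt (Num.max G 0) - Num.sqrt (Num.max (- G) 0))) ^+ 2 <=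
  2 * `|a * `|a| - G|.
Proof.
have key (b c : R) : 0 <= b -> (c - b) ^+ 2 <= 2 * `|c * `|c| - b ^+ 2|.
  move=> b0; have [c0|c0] := leP 0 c.
    rewrite (ger0_norm c0) -expr2; have [bc|bc] := leP b c.
      have p : 0 <= b * (c - b) by rewrite mulr_ge0 ?subr_ge0.
      have q : 0 <= c * (c - b) by rewrite mulr_ge0 ?subr_ge0.
      by rewrite ger0_norm; lra.
    have p : 0 <= c * (b - c) by rewrite mulr_ge0 ?subr_ge0 ?(ltW bc).
    have q : 0 <= b * (b - c) by rewrite mulr_ge0 ?subr_ge0 ?(ltW bc).
    by rewrite ler0_norm; lra.
  have p : 0 <= b * (- c) by rewrite mulr_ge0 ?oppr_ge0 ?(ltW c0).
  have q := sqr_ge0 c; have r := sqr_ge0 b; have t := sqr_ge0 (c + b).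
  by rewrite (ltr0_norm c0) ler0_norm; lra.
have [G0|G0] := leP 0 G.
  have -> : Num.max (- G) 0 = 0 by apply/max_idPr; rewrite oppr_le0.
  rewrite sqrtr0 subr0.
  by have := key (Num.sqrt G) a (sqrtr_ge0 _); rewrite sqr_sqrtr.
have -> : Num.max (- G) 0 = - G by apply/max_idPl; rewrite oppr_ge0 ltW.
rewrite sqrtr0 sub0r opprK.
have := key (Num.sqrt (- G)) (- a) (sqrtr_ge0 _); rewrite sqr_sqrtr ?oppr_ge0 ?(ltW G0) //.
have -> : - a * `|- a| - - G = - (a * `|a| - G) by rewrite normrN; ring.
by rewrite normrN -opprD sqrrN.
Qed.

(* Density of continuous functions is available in L^1 only: it is applied to
   [h * `|h|], and [g] is the signed square root of the approximant. *)
Lemma continuous_dense_L2 (h : R -> R) (eta : R) : L2 mu D h -> 0 < eta ->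
  exists g : R -> R, [/\ continuous g, L2 mu D g &
    Int (fun x => (h x - g x) ^+ 2) <= eta].
Proof.
move=> Lh eta0.
have mabs : measurable_fun D (fun x => `|h x|) by apply: measurableT_comp => //; exact: Lh.1.
have iF : mu.-integrable D (EFin \o (fun x => h x * `|h x|)).
  apply: (@integrable_le _ _ _ mu D mD _ (fun x => h x ^+ 2)); last exact: Lh.2.
    by apply: measurable_funM => //; exact: Lh.1.
  by move=> x _; rewrite normrM normr_id -expr2 real_normK ?num_real.
have finD : (mu D < +oo)%E by rewrite muD ltry.
have [G_ [cG iG cvG]] := approximation_continuous_integrable mD finD iF.
have n0 : nbhs (0%:E : \bar R) [set y | (y < (eta / 2)%:E)%E].
  by apply: (@nbhs_open_ereal_lt _ 0 (fun=> eta / 2)); rewrite divr_gt0.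
have [k _ Hk] := cvG _ n0; have {Hk} := Hk k (leqnn k) => /= ltk.
pose G := G_ k; pose g x := Num.sqrt (Num.max (G x) 0) - Num.sqrt (Num.max (- G x) 0).
have cg : continuous g.
  move=> x; apply: cvgB.
    apply: (@continuous_comp _ _ _ (fun x => Num.max (G x) 0) (@Num.sqrt R)); last exact: sqrt_continuous.
    by apply: (@continuous_max _ _ G (cst 0)); [exact: cG|exact: cvg_cst].
  apply: (@continuous_comp _ _ _ (fun x => Num.max (- G x) 0) (@Num.sqrt R)); last exact: sqrt_continuous.
  by apply: (@continuous_max _ _ (fun x => - G x) (cst 0)); [apply: cvgN; exact: cG|exact: cvg_cst].
have iFG : mu.-integrable D (EFin \o (fun x => h x * `|h x| - G x)).
  exact: (integrableB mD iF (iG k)).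
have mg : measurable_fun D g by apply: measurable_funTS; exact: continuous_measurable_fun.
have mhg : measurable_fun D (fun x => h x - g x) by apply: measurable_funB => //; exact: Lh.1.
have i2 : mu.-integrable D (EFin \o (fun x => 2 * `|h x * `|h x| - G x|)).
  exact: (integrableZl mD 2 (integrable_norm iFG)).
have Lhg : L2 mu D (fun x => h x - g x).
  split => //; apply: (@integrable_le _ _ _ mu D mD _ (fun x => 2 * `|h x * `|h x| - G x|)) => //.
    exact: measurable_funX.
  by move=> x _; rewrite ger0_norm ?sqr_ge0 //; exact: signed_sqrt_dist.
exists g; split => //.
  have := @L2B _ _ _ mu D mD _ _ Lh Lhg; congr (L2 _ _ _); apply/funext => x; ring.
apply: (@le_trans _ _ (Int (fun x => 2 * `|h x * `|h x| - G x|))).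
  by apply: le_Rintegral => //; [exact: Lhg.2|move=> x _; exact: signed_sqrt_dist].
rewrite RintegralZl //; last exact: (integrable_norm iFG).
suff : Int (fun x => `|h x * `|h x| - G x|) <= eta / 2 by move: (Rintegral _ _ _) => z; lra.
rewrite -lee_fin fineK ?ltW //.
apply: integrable_fin_num => //; exact: (integrable_norm iFG).
Qed.

Lemma sine_poly_dense (f : R -> R) (delta eta : R) : L2 mu D f ->
  0 < delta -> (forall x, ~~ (delta <= x <= 1 - delta) -> f x = 0) -> 0 < eta ->
  exists2 T, sine_poly T & L2 mu D T /\ Int (fun x => (f x - T x) ^+ 2) <= eta.
Proof.
move=> Lf delta0 f0 eta0.
have [d2|d2] := leP delta (1 - delta); last first.
  exists (fun x => 0 * sinpi 0 x); first exact/sine_polyZ/sine_poly_sinpi.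
  split; first exact/(L2Z mD)/L2_sinpi.
  under eq_Rintegral.
    move=> x _; rewrite f0; last by apply/negP => /andP[? ?]; lra.
    by rewrite mul0r subrr expr0n; over.
  by rewrite Rintegral_cst // mul0r ltW.
have csin := @continuous_sinl pi.
have [c0 c0I minc] := EVT_min d2 (continuous_subspaceT csin).
set s0 := sin (pi * c0) in minc.
have s0p : 0 < s0.
  move: c0I; rewrite in_itv /= => /andP[? ?]; apply: sin_gt0_pi.
  rewrite mulr_gt0 ?pi_gt0 //=; last lra.
  by rewrite -[ltRHS]mulr1 ltr_pM2l ?pi_gt0 //; lra.
(* [w] is 1 / sin(pi x) on [delta, 1 - delta] and 0 elsewhere. The maximum with [s0], the minimum of
   the sine on that interval, changes nothing there but keeps the denominator positive everywhere,
   which gives measurability and the bound 1 / s0. *)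
pose w x : R := (Num.max s0 (sin (pi * x)))^-1 * \1_(`[delta, 1 - delta]%classic : set R) x.
have mw : measurable_fun D w.
  apply: measurable_funM; last exact: measurable_indic.
  apply: measurable_funTS; apply: continuous_measurable_fun => x; apply: cvgV.
    by rewrite gt_eqF // lt_max s0p.
  by apply: (@continuous_max _ _ (cst s0) (fun x => sin (pi * x))); [exact: cvg_cst|exact: csin].
have wE x : delta <= x <= 1 - delta -> 0 < sin (pi * x) /\ w x = (sin (pi * x))^-1.
  move=> xI; have m : s0 <= sin (pi * x) by apply: minc; rewrite in_itv.
  split; first exact: lt_le_trans m.
  by rewrite /w (max_idPr m) indicE mem_set ?mulr1.
have bw x : `|w x| <= s0^-1.
  rewrite /w indicE; case: (x \in _); last by rewrite mulr0 normr0 invr_ge0 ltW.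
  have p : 0 < Num.max s0 (sin (pi * x)) by rewrite lt_max s0p.
  by rewrite mulr1 ger0_norm ?invr_ge0 ?(ltW p) // lef_pV2 ?posrE // le_max lexx.
pose h x := f x * w x.
have Lh : L2 mu D h by apply: (@L2_mulr _ _ _ mu D mD _ _ s0^-1 Lf mw) => x _; exact: bw.
have fh x : f x = sin (pi * x) * h x.
  rewrite /h; have [xI|xI] := boolP (delta <= x <= 1 - delta); last by rewrite f0 // mul0r mulr0.
  by have [p ->] := wE x xI; rewrite mulrCA mulfV ?mulr1 // gt_eqF.
have eta4 : 0 < eta / 4 by rewrite divr_gt0.
have [g [cg Lg hg]] := continuous_dense_L2 Lh eta4.
(* The minimum with 1 gives (p - g)^2 <= |p - g| <= eta / 4 without a square root; together with (h
   - p)^2 <= 2 (h - g)^2 + 2 (p - g)^2 the total is eta. *)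
have [|m [phi bp]] := @bernstein_cos01_approx _ g (Num.min 1 (eta / 4)) cg.
  by rewrite lt_min ltr01.
pose p x := bernstein m (cos01 x) phi.
pose T x := sin (pi * x) * p x.
have sT : sine_poly T by exact: sine_poly_bernstein.
have LT : L2 mu D T.
  have [K0 [a Ta]] := sT.
  have -> : T = (fun x => \sum_(j < K0) a j * sinpi j x) by apply/funext => x; exact: Ta.
  by apply: (@L2_sum _ _ _ mu D mD muD) => j; apply: (L2Z mD); exact: L2_sinpi.
exists T => //; split => //.
have ihg : mu.-integrable D (EFin \o (fun x => (h x - g x) ^+ 2)) by exact: (@L2B _ _ _ mu D mD _ _ Lh Lg).2.
have i2hg : mu.-integrable D (EFin \o (fun x => 2 * (h x - g x) ^+ 2)) by exact: (integrableZl mD 2 ihg).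
have ic : mu.-integrable D (EFin \o (fun=> eta / 2)).
  by apply: (@integrable_bounded_measurable _ _ _ mu D mD muD _ `|eta / 2|) => // x _.
apply: (@le_trans _ _ (Int (fun x => 2 * (h x - g x) ^+ 2 + eta / 2))).
  apply: le_Rintegral => //.
  - exact: (@L2B _ _ _ mu D mD _ _ Lf LT).2.
  - exact: (integrableD mD i2hg ic).
  move=> x /=; rewrite in_itv /= => /andP[x0 x1].
  have x01 : 0 <= x <= 1 by rewrite !ltW.
  have := bp x x01; rewrite -/(p x) le_min => /andP[p1 p2].
  have s1 : sin (pi * x) ^+ 2 <= 1 by rewrite sin2cos2 gerBl sqr_ge0.
  have gp : (p x - g x) ^+ 2 <= eta / 4.
    rewrite -(real_normK (num_real (p x - g x))) expr2.
    by apply: le_trans p2; rewrite ler_piMl.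
  apply: (@le_trans _ _ ((h x - p x) ^+ 2)).
    by rewrite fh /T -mulrBr exprMn ler_piMl ?sqr_ge0.
  have := sqr_ge0 ((h x - g x) + (p x - g x)); move: (h x) (g x) (p x) gp => a b c; lra.
rewrite RintegralD // RintegralZl // Rintegral_cst //.
rewrite [fine _](_ : _ = 1) ?mulr1; last exact: (congr1 fine muD).
by move: hg; move: (Rintegral _ _ _) => z; lra.
Qed.

Lemma parseval_le (f : R -> R) (delta eta : R) : L2 mu D f ->
  0 < delta -> (forall x, ~~ (delta <= x <= 1 - delta) -> f x = 0) -> 0 < eta ->
  exists K0, forall K, (K0 <= K)%N -> Int (fun x => f x ^+ 2) <=
    eta + 2 * \sum_(j < K) (Int (fun x => f x * sinpi j x)) ^+ 2.
Proof.
move=> Lf d0 f0 eta0; have [T [K0 [a Ta]] [LT fT]] := sine_poly_dense Lf d0 f0 eta0.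
exists K0 => K k0; apply: (le_trans (bessel_best_approximation a K Lf)).
rewrite lerD2r; apply: le_trans fT; rewrite le_eqVlt; apply/orP; left; apply/eqP.
by apply: eq_Rintegral => x _; rewrite (Ta _ k0).
Qed.

End Parseval.

(** * Extrapolation of sines *)

Section Extrapolation.
Context {R : realType}.
Implicit Types (x y kappa : R) (m K : nat).

Lemma exprn_le_fact_expR x m : 0 <= x -> x ^+ m <= m`!%:R * expR x.
Proof.
move=> x0; case: m => [|m].
  by rewrite expr0 fact0 mul1r -[leLHS]expR0 ler_expR.
rewrite mulrC -ler_pdivrMr ?ltr0n ?fact_gt0 //.
by apply: le_trans (expR_ge1Dxn m x0); rewrite lerDr.
Qed.

Lemma expR1_le4 : expR 1 <= 4 :> R.
Proof.
have h : expR (1 / 2) <= 2 :> R.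
  have := expR_ge1Dx (- (1 / 2) : R); rewrite expRN => h.
  have e0 := expR_gt0 (1 / 2 : R).
  rewrite -(@ler_pV2 R) ?inE ?unitfE ?gt_eqF ?e0 //; last exact/ltr0n.
  by apply: le_trans h; lra.
have -> : (1 : R) = 1 / 2 + 1 / 2 by field.
have := expR_ge0 (1 / 2 : R); rewrite expRD; nra.
Qed.

(** The shifts by one keep all nodes strictly inside (0,1), the range over which eps4 is a
    supremum. *)
Definition node m (i : 'I_m) : R := i.+1%:R / m.+1%:R.

Lemma node_gt0 m (i : 'I_m) : 0 < node i.
Proof. by rewrite divr_gt0. Qed.

Lemma node_lt1 m (i : 'I_m) : node i < 1.
Proof. by rewrite ltr_pdivrMr // mul1r ltr_nat ltnS. Qed.

Lemma node_inj m : injective (@node m).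
Proof.
move=> i j /(mulIf _) h; apply: val_inj; apply: succn_inj; apply/eqP.
by rewrite -(eqr_nat R); apply/eqP; apply: h; rewrite invr_eq0 pnatr_eq0.
Qed.

Definition lagrange_weight m kappa (i : 'I_m) : R :=
  \prod_(j < m | j != i) ((kappa - node j) / (node i - node j)).

(** Interpolation at m nodes reproduces polynomials of degree below m: the difference of X^k and its
    interpolant has size at most m and vanishes at m distinct nodes. *)
Lemma lagrange_weight_exact m kappa k : (k < m)%N ->
  \sum_(i < m) lagrange_weight kappa i * node i ^+ k = kappa ^+ k.
Proof.
move=> km.
pose L (i : 'I_m) : {poly R} := \prod_(j < m | j != i) ((node i - node j)^-1 *: ('X - (node j)%:P)).
have LE (i : 'I_m) x : (L i).[x] = \prod_(j < m | j != i) ((x - node j) / (node i - node j)).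
  rewrite horner_prod; apply: eq_bigr => j _.
  by rewrite hornerZ hornerXsubC mulrC.
have sL (i : 'I_m) : (size (L i) <= m)%N.
  apply: leq_trans (size_prod_leq _ _) _ => /=.
  apply: (@leq_trans ((\sum_(j < m | j != i) 2).+1 - #|[pred j : 'I_m | j != i]|)).
    apply: leq_sub2r; rewrite ltnS; apply: leq_sum => j ji.
    by rewrite (leq_trans (size_scale_leq _ _)) // size_XsubC.
  rewrite sum_nat_const muln2 -addnn -addSn addnK.
  have := cardC1 i; rewrite card_ord => c.
  have -> : #|[pred j : 'I_m | j != i]| = m.-1 by rewrite -c; apply: eq_card => j.
  by rewrite prednK // (leq_ltn_trans _ (ltn_ord i)).
pose q : {poly R} := \sum_(i < m) node i ^+ k *: L i - 'X^k.
suff q0 : q = 0.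
  have := congr1 (horner^~ kappa) q0; rewrite /q hornerD hornerN hornerXn horner0 horner_sum.
  move/subr0_eq <-; apply: eq_bigr => i _.
  by rewrite hornerZ LE mulrC.
apply: (@roots_geq_poly_eq0 _ _ [seq node i | i <- enum 'I_m]).
- apply/allP => _ /mapP[l _ ->]; rewrite rootE /q hornerD hornerN hornerXn horner_sum.
  rewrite (bigD1 l) //= big1 ?addr0 => [|i il].
    rewrite hornerZ LE big1 ?mulr1 ?subrr // => j jl; rewrite divff // subr_eq0.
    by apply: contra_neq jl => /node_inj.
  by rewrite hornerZ LE (bigD1 l) 1?eq_sym //= subrr mul0r mul0r mulr0.
- by rewrite (map_inj_uniq (@node_inj m)) enum_uniq.
- rewrite size_map size_enum_ord (leq_trans (size_polyD _ _)) // size_polyN size_polyXn geq_max km andbT.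
  apply: (leq_trans (size_sum _ _ _)); apply/bigmax_leqP => i _.
  exact: leq_trans (size_scale_leq _ _) (sL i).
Qed.

(** The factors to the left of i form a falling factorial, which is the case r = 0; each further
    factor on the right contributes the next integer. *)
Lemma prod_dist_ord (i r : nat) :
  \prod_(j < i + r.+1 | j != i :> nat) `|i%:R - j%:R| = (i`! * r`!)%:R :> R.
Proof.
elim: r => [|r IH].
  rewrite addn1 big_mkcond big_ord_recr /= eqxx /= mulr1 fact0 muln1 -ffactnn ffact_prod natr_prod.
  apply: eq_bigr => j _; rewrite ltn_eqF //= natrB ?(ltnW (ltn_ord j)) // ger0_norm //.
  by rewrite subr_ge0 ler_nat ltnW.
rewrite addnS big_mkcond big_ord_recr /= -big_mkcond IH.
have -> : (i + r.+1 != i)%N by rewrite -[X in _ != X]addn0 eqn_add2l.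
rewrite distrC natrD addrAC subrr add0r normr_nat factS -natrM; congr _%:R.
by rewrite mulnCA mulnC mulnA.
Qed.

(** Each numerator is at most kappa, since 0 < node < 1 <= kappa. The denominators are integers over
    m + 1 with product i! (m - 1 - i)!, written through a binomial coefficient so that the sum over
    i becomes a power of 2. *)
Lemma norm_lagrange_weight_le m kappa (i : 'I_m) : 1 <= kappa ->
  `|lagrange_weight kappa i| <= (kappa * m.+1%:R) ^+ m.-1 / m.-1`!%:R * 'C(m.-1, i)%:R.
Proof.
case: m i => [[] //|m] i k1; rewrite /= /lagrange_weight normr_prod.
apply: (@le_trans _ _ (\prod_(j < m.+1 | j != i) ((kappa * m.+2%:R) / `|i%:R - j%:R|))).
  apply: ler_prod => j ji; rewrite normr_ge0 /= normrM normfV.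
  have -> : node i - node j = (i%:R - j%:R) / m.+2%:R.
    by rewrite /node -mulrBl -[i.+1]addn1 -[j.+1]addn1 !natrD; congr (_ / _); ring.
  rewrite normrM normfV normr_nat invfM invrK mulrA -mulrA mulrAC mulrA.
  rewrite ler_wpM2r ?invr_ge0 // ler_wpM2r //.
  have := node_lt1 j; have := node_gt0 j; rewrite ler_norml; lra.
rewrite big_split /= prodr_const prodfV.
have -> : #|[pred j : 'I_m.+1 | j != i]| = m.
  by rewrite (@eq_card _ _ (predC1 i)) ?cardC1 ?card_ord.
have im : (i <= m)%N by rewrite -ltnS.
have := prod_dist_ord i (m - i); rewrite addnS subnKC // => ->.
rewrite -mulrA ler_wpM2l ?exprn_ge0 ?mulr_ge0 //; first by rewrite (le_trans _ k1).
rewrite -(bin_fact im) [in leRHS]natrM invfM mulrAC.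
by rewrite mulVf ?mul1r // pnatr_eq0 -lt0n bin_gt0.
Qed.

Lemma sum_norm_lagrange_weight_le m kappa : 1 <= kappa ->
  \sum_(i < m) `|lagrange_weight kappa i| <= (2 * kappa) ^+ m * expR m.+1%:R.
Proof.
move=> k1; have k0 : 0 <= kappa by rewrite (le_trans _ k1).
apply: (le_trans (ler_sum _ (fun i _ => norm_lagrange_weight_le i k1))).
rewrite -mulr_sumr; case: m => [|m] /=.
  by rewrite big_ord0 mulr0 mulr_ge0 ?exprn_ge0 ?expR_ge0 ?mulr_ge0.
have -> : \sum_(i < m.+1) 'C(m, i)%:R = 2 ^+ m :> R.
  rewrite -natr_sum; have := expnDn 1 1 m; rewrite addn1 => h; rewrite -natrX h.
  by congr _%:R; apply: eq_bigr => i _; rewrite !exp1n !muln1.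
have e := @exprn_le_fact_expR m.+2%:R m (ler0n _ _).
have -> : (kappa * m.+2%:R) ^+ m / m`!%:R * 2 ^+ m = (2 * kappa) ^+ m * (m.+2%:R ^+ m / m`!%:R).
  by rewrite !exprMn; ring.
apply: (@le_trans _ _ ((2 * kappa) ^+ m * expR m.+2%:R)).
  by rewrite ler_wpM2l ?exprn_ge0 ?mulr_ge0 // ler_pdivrMr ?ltr0n ?fact_gt0 // mulrC.
rewrite ler_wpM2r ?expR_ge0 // exprS ler_peMl ?exprn_ge0 ?mulr_ge0 //; lra.
Qed.

Lemma norm_sin_coeff_le x n : `|sin_coeff x n| <= `|x| ^+ n / n`!%:R.
Proof.
rewrite /sin_coeff normrM normfV normr_nat ler_wpM2r ?invr_ge0 //.
rewrite normrM normrX ler_piMl ?exprn_ge0 // normrM normrX normrN1 expr1n mulr1.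
by case: (odd n); rewrite ?normr1 ?normr0.
Qed.

Lemma sum_exp_coeff_le x n : 0 <= x -> \sum_(k < n) x ^+ k / k`!%:R <= expR x.
Proof.
move=> x0; have -> : \sum_(k < n) x ^+ k / k`!%:R = series (exp_coeff x) n :> R.
  by rewrite /series /= big_mkord.
rewrite /expR; apply: nondecreasing_cvgn_le; last exact: is_cvg_series_exp_coeff.
apply/nondecreasing_seqP => k; rewrite /series /= big_nat_recr //= lerDl.
exact: exp_coeff_ge0.
Qed.

(** Since m! k! <= (m + k)!, the term of order m + k is at most |x|^m / m! times the k-th
    exponential term; summing over k gives the factor exp(|x|). *)
Lemma sin_taylor x m :
  `|sin x - \sum_(k < m) sin_coeff x k| <= `|x| ^+ m / m`!%:R * expR `|x|.
Proof.
have h n : `|\sum_(0 <= k < n + m) sin_coeff x k - \sum_(k < m) sin_coeff x k| <= `|x| ^+ m / m`!%:R * expR `|x|.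
  rewrite -(big_mkord xpredT (fun k => sin_coeff x k)) (@big_cat_nat _ _ _ m) ?leq_addl //= addrAC subrr add0r.
  rewrite -{1}[m]add0n big_addn addnK big_mkord.
  apply: (le_trans (ler_norm_sum _ _ _)).
  apply: (@le_trans _ _ (\sum_(k < n) `|x| ^+ m / m`!%:R * (`|x| ^+ k / k`!%:R))).
    apply: ler_sum => k _; apply: (le_trans (norm_sin_coeff_le _ _)).
    rewrite mulrACA -exprD addnC ler_wpM2l ?exprn_ge0 // -invfM -natrM.
    rewrite lef_pV2 ?posrE ?ltr0n ?muln_gt0 ?fact_gt0 // ler_nat.
    have := bin_fact (leq_addr k m); rewrite addnC addnK addnC => <-.
    by rewrite leq_pmull // bin_gt0 leq_addr.
  rewrite -mulr_sumr ler_wpM2l ?mulr_ge0 ?exprn_ge0 ?invr_ge0 //.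
  exact: sum_exp_coeff_le.
have c : series (sin_coeff x) @ \oo --> sin x.
  by rewrite unlock; exact: is_cvg_series_sin_coeff.
have c' : (fun n => `|series (sin_coeff x) (n + m)%N - \sum_(k < m) sin_coeff x k|) @ \oo
    --> `|sin x - \sum_(k < m) sin_coeff x k|.
  apply: cvg_norm; apply: cvgB; last exact: cvg_cst.
  by rewrite (cvg_shiftn m (series (sin_coeff x))).
rewrite -(cvg_lim _ c') //; apply: limr_le; first by apply/cvg_ex; eexists; exact: c'.
by near=> n; exact: h.
Unshelve. all: by end_near. Qed.

(** The weights are exact on the Taylor polynomial of degree below m in kappa, so only Taylor
    remainders survive: one at kappa, and one at each node, where it is at most e / m! because nodes
    lie below 1. *)
Lemma sin_extrapolation_error m kappa y : (0 < m)%N -> 1 <= kappa -> 0 <= y <= 1 ->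
  `|sin (kappa * y) - \sum_(i < m) lagrange_weight kappa i * sin (node i * y)| <=
  kappa ^+ m / m`!%:R * expR kappa +
  (\sum_(i < m) `|lagrange_weight kappa i|) * (expR 1 / m`!%:R).
Proof.
move=> m0 k1 /andP[y0 y1]; have k0 : 0 <= kappa by rewrite (le_trans _ k1).
pose p t := \sum_(k < m) sin_coeff (t * y) k : R.
have ex : \sum_(i < m) lagrange_weight kappa i * p (node i) = p kappa.
  under eq_bigr do rewrite /p mulr_sumr; rewrite exchange_big /=; apply: eq_bigr => k _.
  rewrite /sin_coeff /= !exprMn -(lagrange_weight_exact kappa (ltn_ord k)) !(mulr_suml, mulr_sumr).
  by apply: eq_bigr => i _; rewrite /= exprMn; ring.
have er t : 0 <= t -> `|sin (t * y) - p t| <= t ^+ m / m`!%:R * expR t.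
  move=> t0; apply: (le_trans (sin_taylor _ _)).
  have ty0 : 0 <= t * y by rewrite mulr_ge0.
  have tyt : t * y <= t by rewrite ler_piMr.
  rewrite (ger0_norm ty0); apply: ler_pM; rewrite ?mulr_ge0 ?exprn_ge0 ?invr_ge0 ?expR_ge0 ?ler_expR //.
  by rewrite ler_wpM2r ?invr_ge0 // lerXn2r ?nnegrE.
have -> : sin (kappa * y) - \sum_(i < m) lagrange_weight kappa i * sin (node i * y) =
   (sin (kappa * y) - p kappa) - \sum_(i < m) lagrange_weight kappa i * (sin (node i * y) - p (node i)).
  have -> : \sum_(i < m) lagrange_weight kappa i * (sin (node i * y) - p (node i)) =
    \sum_(i < m) lagrange_weight kappa i * sin (node i * y) - p kappa.
    by rewrite -ex -sumrB; apply: eq_bigr => i _; rewrite mulrBr.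
  by ring.
apply: (le_trans (ler_normB _ _)); apply: lerD; first exact: er.
apply: (le_trans (ler_norm_sum _ _ _)); rewrite mulr_suml; apply: ler_sum => i _.
rewrite normrM ler_wpM2l //; apply: (le_trans (er _ (ltW (node_gt0 i)))).
rewrite mulrC; apply: ler_pM; rewrite ?mulr_ge0 ?exprn_ge0 ?invr_ge0 ?expR_ge0 ?ler_expR //.
- exact: ltW (node_gt0 i).
- exact: ltW (node_lt1 i).
- by rewrite ler_piMl ?invr_ge0 // exprn_ile1 ?ltW ?node_gt0 ?node_lt1.
Qed.

(** The bound t^m <= m! exp(t) at t = e x, with e <= 4: once m exceeds 4 x the quotient is
    exponentially small. *)
Lemma expR_powM_fact_le x m : 0 <= x -> x ^+ m / m`!%:R <= expR (4 * x - m%:R).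
Proof.
move=> x0; have e0 := expR_gt0 (1 : R).
have h := @exprn_le_fact_expR (expR 1 * x) m (mulr_ge0 (ltW e0) x0).
rewrite ler_pdivrMr ?ltr0n ?fact_gt0 // expRB mulrAC ler_pdivlMr ?expR_gt0 //.
rewrite -[m%:R]mulr1 (expRM_natl m) -exprMn (mulrC x) [leRHS]mulrC.
apply: (le_trans h); rewrite ler_wpM2l // ler_expR ler_wpM2r //.
exact: expR1_le4.
Qed.

Lemma sin_extrapolation K kappa : (0 < K)%N -> 1 <= kappa -> kappa <= 4 * K%:R ->
  exists m (w t : 'I_m -> R), [/\ forall i, 0 < t i < 1,
    \sum_(i < m) `|w i| <= expR (1200 * K%:R ^+ 2) &
    forall y, 0 <= y <= 1 ->
      `|sin (kappa * y) - \sum_(i < m) w i * sin (t i * y)| <= 17 * expR (- K%:R)].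
Proof.
move=> K0 k1 kK; have k0 : 0 <= kappa by rewrite (le_trans _ k1).
have K1 : 1 <= K%:R :> R by rewrite ler1n.
(* The weighted node remainders amount to e^2 (2 kappa e)^m / m!. Here 2 kappa e <= 32 K, so this is
   at most 16 exp(128 K - m), and m = 129 K leaves 16 exp(-K). *)
exists (129 * K)%N, (@lagrange_weight _ kappa), (@node _).
set m := (129 * K)%N; have m0 : (0 < m)%N by rewrite muln_gt0.
have mE : m%:R = 129 * K%:R :> R by rewrite natrM.
have W := @sum_norm_lagrange_weight_le m _ k1.
split.
- by move=> i; rewrite node_gt0 node_lt1.
(* With 2 kappa <= exp(2 kappa) the exponent is at most 8 K times 129 K, plus 129 K + 1; 1200 K^2
   covers both. *)
- apply: (le_trans W); apply: (@le_trans _ _ (expR (2 * kappa) ^+ m * expR m.+1%:R)).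
    rewrite ler_wpM2r ?expR_ge0 // lerXn2r ?nnegrE ?expR_ge0 ?mulr_ge0 //.
    by apply: le_trans (expR_ge1Dx _); rewrite lerDr.
  rewrite -expRM_natr -expRD ler_expR -[m.+1]addn1 natrD mE; nra.
- move=> y y01; apply: (le_trans (sin_extrapolation_error m0 k1 y01)).
  have -> : 17 * expR (- K%:R) = expR (- K%:R) + 16 * expR (- K%:R) :> R by ring.
  apply: lerD.
    apply: (@le_trans _ _ (expR (4 * kappa - m%:R) * expR kappa)).
      by rewrite ler_wpM2r ?expR_ge0 ?expR_powM_fact_le.
    by rewrite -expRD ler_expR mE; lra.
  have e4 := expR1_le4; have e0 := expR_gt0 (1 : R).
  apply: (@le_trans _ _ ((2 * kappa) ^+ m * expR m.+1%:R * (expR 1 / m`!%:R))).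
    by rewrite ler_wpM2r // mulr_ge0 ?invr_ge0 // ltW.
  have -> : (2 * kappa) ^+ m * expR m.+1%:R * (expR 1 / m`!%:R) =
      expR 1 ^+ 2 * ((2 * kappa * expR 1) ^+ m / m`!%:R).
    rewrite -[m.+1%:R]mulr1 (expRM_natl m.+1) exprS (exprMn _ (2 * kappa)); ring.
  have q0 : 0 <= 2 * kappa * expR 1 by rewrite !mulr_ge0 // ltW.
  apply: ler_pM; [exact: sqr_ge0|by rewrite divr_ge0 ?exprn_ge0|nra|].
  apply: (le_trans (expR_powM_fact_le m q0)).
  by rewrite ler_expR mE; nra.
Qed.

End Extrapolation.

(** * Smooth cutoffs *)

Section SmoothFunctions.
Context {R : realType}.
Implicit Types (f g : R -> R) (n k m : nat) (a b c x y : R).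

(** The recursion passes through the first derivative, so closure under sums, products and
    reciprocals follows by induction from the one-step derivative formulas. *)
Fixpoint smoothn n f : Prop :=
  if n is n'.+1 then (forall x, derivable f x 1) /\ smoothn n' (f^`())%classic
  else True.

Definition smooth f := forall n, smoothn n f.

Lemma is_derive_derive1 f f' : (forall x, is_derive x 1 f (f' x)) -> (f^`())%classic = f'.
Proof. by move=> df; apply/funext => x; rewrite derive1E; case: (df x). Qed.

Lemma derivable_is_derive1 f x : derivable f x 1 -> is_derive x 1 f ((f^`())%classic x).
Proof. by move=> df; rewrite derive1E; exact: derivableP. Qed.

Lemma smoothnS n f f' : (forall x, is_derive x 1 f (f' x)) -> smoothn n f' -> smoothn n.+1 f.
Proof.
by move=> df sf'; split; [move=> x; case: (df x)|rewrite (is_derive_derive1 df)].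
Qed.

Lemma smoothn_pred n f : smoothn n.+1 f -> smoothn n f.
Proof.
elim: n f => [//|n IH] f [df sf]; split => //; exact: IH.
Qed.

Lemma smoothn_cst n c : smoothn n (cst c).
Proof.
elim: n c => [//|n IH] c.
by apply: (@smoothnS _ _ (cst 0)) => // x; exact: is_derive_cst.
Qed.

Lemma smoothnD n f g : smoothn n f -> smoothn n g -> smoothn n (fun x => f x + g x).
Proof.
elim: n f g => [//|n IH] f g [df sf] [dg sg].
have D x : is_derive x 1 (fun x => f x + g x) ((f^`())%classic x + (g^`())%classic x).
  by apply: is_deriveD; exact: derivable_is_derive1.
exact: (smoothnS D (IH _ _ sf sg)).
Qed.

Lemma smoothnM n f g : smoothn n f -> smoothn n g -> smoothn n (fun x => f x * g x).
Proof.
elim: n f g => [//|n IH] f g sf sg; have [df sf'] := sf; have [dg sg'] := sg.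
have D x : is_derive x 1 (fun x => f x * g x) (f x * (g^`())%classic x + g x * (f^`())%classic x).
  by apply: is_deriveM; exact: derivable_is_derive1.
by apply: (smoothnS D); apply: smoothnD; apply: IH => //; exact: smoothn_pred.
Qed.

Lemma smoothnZ n c f : smoothn n f -> smoothn n (fun x => c * f x).
Proof. by apply: smoothnM; exact: smoothn_cst. Qed.

Lemma smoothnV n f : (forall x, f x != 0) -> smoothn n f -> smoothn n (fun x => (f x)^-1).
Proof.
move=> f0; elim: n => [//|n IH] sf; have [df sf'] := sf.
have D x : is_derive x 1 (fun x => (f x)^-1) ((-1) * ((f x)^-1 * (f x)^-1 * (f^`())%classic x)).
  apply: DeriveDef; first exact: derivableV.
  by rewrite deriveV // derive1E /GRing.scale /= mulN1r -expr2 exprVn mulNr.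
apply: (smoothnS D); apply: smoothnZ; apply: smoothnM => //; apply: smoothnM; apply: IH; exact: smoothn_pred.
Qed.

Lemma is_derive_affine a b x : is_derive x 1 (fun y => a * y + b) a.
Proof.
have -> : (fun y => a * y + b) = (a *: @id R) + cst b by apply/funext.
by apply: is_derive_eq; rewrite addr0 /GRing.scale /= mulr1.
Qed.

Lemma is_derive_comp_affine f a b d x : is_derive (a * x + b) 1 f d ->
  is_derive x 1 (fun y => f (a * y + b)) (a * d).
Proof.
move=> df; have := @is_derive1_comp _ f (fun y => a * y + b) x d a df (is_derive_affine a b x).
by rewrite mulrC.
Qed.

Lemma smoothn_comp_affine n f a b : smoothn n f -> smoothn n (fun x => f (a * x + b)).
Proof.
elim: n f => [//|n IH] f [df sf].
have D x : is_derive x 1 (fun x => f (a * x + b)) (a * (f^`())%classic (a * x + b)).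
  by apply: is_derive_comp_affine; exact: derivable_is_derive1.
by apply: (smoothnS D); apply: smoothnZ; exact: IH.
Qed.

Lemma smoothn_sin_cos n : smoothn n (@sin R) /\ smoothn n (@cos R).
Proof.
elim: n => [//|n [IHs IHc]]; split; first exact: (smoothnS (@is_derive_sin R) IHc).
have D (x : R) : is_derive x 1 (@cos R) ((-1) * sin x) by rewrite mulN1r; exact: is_derive_cos.
by apply: (smoothnS D); exact: smoothnZ.
Qed.

Lemma smooth_sin_affine a b : smooth (fun x => sin (a * x + b)).
Proof. by move=> n; apply: smoothn_comp_affine; exact: (smoothn_sin_cos n).1. Qed.

Lemma smooth_sum (I : Type) (s : seq I) (h : I -> R -> R) :
  (forall i, smooth (h i)) -> smooth (fun x => \sum_(i <- s) h i x).
Proof.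
move=> sh n; elim: s => [|i s IH].
  by under eq_fun do rewrite big_nil; exact: smoothn_cst.
by under eq_fun do rewrite big_cons; apply: smoothnD => //; exact: sh.
Qed.

Lemma derive1nSr k f : derive1n k.+1 f = derive1n k (f^`())%classic.
Proof. by rewrite /derive1n iterSr. Qed.

Lemma smooth_derivable f k x : smooth f -> derivable (derive1n k f) x 1.
Proof.
elim: k f => [|k IH] f sf; first by case: (sf 1%N).
by rewrite derive1nSr; apply: IH => n; case: (sf n.+1).
Qed.

Lemma continuous_derive1n f k : smooth f -> continuous (derive1n k f).
Proof.
move=> sf x; apply/differentiable_continuous/derivable1_diffP.
exact: smooth_derivable.
Qed.

Lemma derive1n_local (A : set R) f g k : open A -> {in A, f =1 g} ->
  {in A, derive1n k f =1 derive1n k g}.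
Proof.
move=> oA; elim: k f g => [|k IH] f g fg; first exact: fg.
rewrite !derive1nSr; apply: IH => x xA; rewrite !derive1E; apply: near_eq_derive.
have := open_nbhs_nbhs (conj oA (set_mem xA)); apply: filterS => y Ay.
by apply: fg; rewrite inE.
Qed.

(** Each derivative advances the phase by a quarter turn. This form avoids a case distinction modulo
    4 and lets a suitable initial phase make the n-th derivative a pure sine. *)
Lemma derive1n_sin_affine a b k :
  derive1n k (fun x => sin (a * x + b)) = fun x => a ^+ k * sin (a * x + (b + k%:R * (pi / 2))).
Proof.
elim: k b => [|k IH] b.
  by apply/funext => x; rewrite expr0 mul1r mul0r addr0.
rewrite derive1nSr.
have -> : (fun x => sin (a * x + b))^`()%classic = (fun x => a * sin (a * x + (b + pi / 2))).
  apply: is_derive_derive1 => x; rewrite addrA sinDpihalf.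
  by apply: is_derive_comp_affine; exact: is_derive_sin.
have e c f : smooth f -> derive1n k (fun x => c * f x) = fun x => c * derive1n k f x.
  elim: k {IH} f => [//|k IH] f sf; rewrite !derive1nSr -IH; last by move=> n; case: (sf n.+1).
  congr derive1n; apply: is_derive_derive1 => x.
  have := @is_deriveZ _ _ _ f c x 1 _ (derivable_is_derive1 ((sf 1%N).1 x)).
  by [].
rewrite e; last exact: smooth_sin_affine.
apply/funext => x; rewrite IH mulrA -exprS -[k.+1]addn1 natrD; congr (_ * sin _); ring.
Qed.

End SmoothFunctions.

(** * A compactly supported cutoff built from exp(-1/x) *)

Section BumpFunction.
Context {R : realType}.
Implicit Types (m n : nat) (x y : R).

(* The exponent [m] makes the family stable under differentiation. *)
Definition flat m x : R := if 0 < x then x ^- m * expR (- x^-1) else 0.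

Lemma flat_ge0 m x : 0 <= flat m x.
Proof.
rewrite /flat; case: ifP => // x0.
by rewrite mulr_ge0 ?expR_ge0 // invr_ge0 exprn_ge0 // ltW.
Qed.

(** The bound t^(m+2) <= (m+2)! exp(t) at t = 1/x. Quadratic smallness for every [m] is what gives
    each member of the family derivative 0 at the origin. *)
Lemma flat_le m x : flat m x <= (m + 2)`!%:R * x ^+ 2.
Proof.
rewrite /flat; case: ifP => x0; last by rewrite mulr_ge0 ?sqr_ge0.
have xV : 0 <= x^-1 by rewrite invr_ge0 ltW.
have h := @exprn_le_fact_expR R x^-1 (m + 2) xV.
rewrite expRN ler_pdivrMr ?expR_gt0 // -exprVn.
have -> : x^-1 ^+ m = x^-1 ^+ (m + 2) * x ^+ 2.
  by rewrite exprD -mulrA -exprMn mulVf ?gt_eqF // expr1n mulr1.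
by rewrite mulrAC ler_wpM2r ?sqr_ge0.
Qed.

Lemma is_derive_quadratic_zero (f : R -> R) (C : R) :
  (forall x, `|f x| <= C * x ^+ 2) -> is_derive (0 : R) 1 f 0.
Proof.
move=> fC.
have f0 : f 0 = 0 by apply/eqP; rewrite -normr_le0 (le_trans (fC 0)) // expr0n mulr0.
have C0 : 0 <= C by have := fC 1; rewrite expr1n mulr1; exact: le_trans.
have cv : (fun h : R => h^-1 *: ((f \o shift 0) (h *: (1 : R)) - f 0)) @ 0^' --> (0 : R).
  apply/cvgrPdist_le => e e0; near=> h.
  have h0 : h != 0 by near: h; exact: nbhs_dnbhs_neq.
  rewrite sub0r normrN /= /GRing.scale /= mulr1 addr0 f0 subr0 normrM normfV.
  have hp : 0 < `|h| by rewrite normr_gt0.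
  rewrite mulrC ler_pdivrMr //; apply: (le_trans (fC h)).
  rewrite -(real_normK (num_real h)) expr2 mulrA ler_wpM2r ?(ltW hp) //.
  have : `|h| <= e / (C + 1).
    by near: h; apply: dnbhs0_le; apply: divr_gt0 => //; apply: ltr_wpDl.
  rewrite ler_pdivlMr; last exact: ltr_wpDl.
  by move=> hC; apply: le_trans hC; rewrite mulrC ler_wpM2l // lerDl.
split; first by apply/cvg_ex; exists 0.
exact: cvg_lim cv.
Unshelve. all: by end_near. Qed.

Lemma is_derive_flat m x :
  is_derive x 1 (flat m) ((- m%:R) * flat m.+1 x + flat m.+2 x).
Proof.
have [x0|x0|->] := ltrgt0P x; last first.
- have -> : - m%:R * flat m.+1 0 + flat m.+2 0 = 0 by rewrite /flat ltxx mulr0 addr0.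
  apply: (@is_derive_quadratic_zero _ (m + 2)`!%:R) => y.
  by rewrite ger0_norm ?flat_ge0 // flat_le.
- have -> : - m%:R * flat m.+1 x + flat m.+2 x = 0.
    by rewrite /flat ltNge (ltW x0) /= mulr0 addr0.
  have H : \near x, cst 0 x = flat m x.
    by near=> y; rewrite /flat ltNge ltW //=; near: y; exact: lt_nbhsl.
  exact: (near_eq_is_derive H (is_derive_cst _ _ _)).
pose h y : R := y^-1 ^+ m * expR (- y^-1).
have Hh : \near x, h x = flat m x.
  near=> y; rewrite /flat /h ifT ?exprVn //; near: y; exact: lt_nbhsr.
have xn : x != 0 by rewrite gt_eqF.
have dV : is_derive x 1 (fun y : R => y^-1) (- x ^- 2).
  apply: DeriveDef; first by apply: derivableV => //; exact: derivable_id.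
  by rewrite deriveV // derive_id /GRing.scale /= mulr1.
have dE : is_derive x 1 (fun y : R => expR (- y^-1)) (expR (- x^-1) * x ^- 2).
  apply: (@is_derive1_comp _ expR (fun y => - y^-1)).
  by have := @is_deriveN _ _ _ (fun y : R => y^-1) x 1 _ dV; rewrite opprK.
have dX : is_derive x 1 (fun y : R => y^-1 ^+ m) (m%:R * x^-1 ^+ m.-1 * (- x ^- 2)).
  have := @is_deriveX _ _ (fun y : R => y^-1) m x 1 _ dV; rewrite exprfctE => H.
  by apply: is_derive_eq H _; rewrite /GRing.scale /= mulr_natl.
have dh : is_derive x 1 h (x^-1 ^+ m * (expR (- x^-1) * x ^- 2) +
    expR (- x^-1) * (m%:R * x^-1 ^+ m.-1 * (- x ^- 2))).
  exact: is_deriveM.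
apply: is_derive_eq (near_eq_is_derive Hh dh) _.
rewrite /flat x0 -!exprVn !exprS; move: (expR _) => E.
by case: (m) => [|k] /=; rewrite ?expr0 ?exprS; ring.
Unshelve. all: by end_near. Qed.

Lemma smooth_flat m : smooth (flat m).
Proof.
move=> n; elim: n m => [//|n IH] m; apply: (smoothnS (is_derive_flat m)).
by apply: smoothnD => //; exact: smoothnZ.
Qed.

Definition smoothstep x : R := flat 0 x / (flat 0 x + flat 0 (1 - x)).

Lemma smoothstep_den_gt0 x : 0 < flat 0 x + flat 0 (1 - x).
Proof.
have p y : 0 < y -> 0 < flat 0 y by move=> y0; rewrite /flat y0 expr0 invr1 mul1r expR_gt0.
have [x0|x0] := ltP 0 x; first by rewrite ltr_wpDr ?flat_ge0 ?p.
by rewrite ltr_wpDl ?flat_ge0 // p; lra.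
Qed.

Lemma smooth_smoothstep : smooth smoothstep.
Proof.
move=> n; apply: smoothnM; first exact: smooth_flat.
apply: smoothnV => [x|]; first by rewrite gt_eqF // smoothstep_den_gt0.
apply: smoothnD; first exact: smooth_flat.
have -> : (fun x => flat 0 (1 - x)) = (fun x => flat 0 ((-1) * x + 1)).
  by apply/funext => x; congr flat; ring.
by apply: smoothn_comp_affine; exact: smooth_flat.
Qed.

Lemma smoothstep_bounds x : 0 <= smoothstep x <= 1.
Proof.
rewrite /smoothstep divr_ge0 ?flat_ge0 ?(ltW (smoothstep_den_gt0 _)) //= ler_pdivrMr ?smoothstep_den_gt0 //.
by rewrite mul1r lerDl flat_ge0.
Qed.

Lemma smoothstep0 x : x <= 0 -> smoothstep x = 0.
Proof. by move=> x0; rewrite /smoothstep {1}/flat ltNge x0 mul0r. Qed.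

Lemma smoothstep1 x : 1 <= x -> smoothstep x = 1.
Proof.
move=> x1; have := smoothstep_den_gt0 x; rewrite /smoothstep.
have -> : flat 0 (1 - x) = 0 by rewrite /flat ltNge subr_le0 x1.
by rewrite addr0 => p; rewrite divff // gt_eqF.
Qed.

Lemma exists_cutoff (delta : R) : 0 < delta ->
  exists chi : R -> R, [/\ smooth chi, forall x, 0 <= chi x <= 1,
    closure [set x | chi x != 0] `<=` `]0, 1[ &
    forall x, delta / 2 < x < 1 - delta / 2 -> chi x = 1].
Proof.
(* [L] vanishes up to delta / 4 and equals 1 from delta / 2 on; the cutoff is [L] times its mirror
   image about 1/2. *)
move=> d0; pose L x := smoothstep (4 / delta * x + (- 1)).
exists (fun x => L x * L ((-1) * x + 1)); split.
- move=> n; apply: smoothnM; first by apply: smoothn_comp_affine; exact: smooth_smoothstep.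
  by apply: smoothn_comp_affine; apply: smoothn_comp_affine; exact: smooth_smoothstep.
- move=> x; have /andP[a0 a1] := smoothstep_bounds (4 / delta * x + (- 1)).
  have /andP[b0 b1] := smoothstep_bounds (4 / delta * ((-1) * x + 1) + (- 1)).
  by rewrite mulr_ge0 //= mulr_ile1.
- have L0 x : x <= delta / 4 -> L x = 0.
    move=> xd; apply: smoothstep0; rewrite subr_le0 mulrAC ler_pdivrMr // mul1r; lra.
  have : [set x | L x * L ((-1) * x + 1) != 0] `<=` `[delta / 4, 1 - delta / 4].
    move=> x /=; rewrite in_itv /=; apply: contraR; rewrite negb_and -!ltNge => /orP[h|h].
      by rewrite L0 ?mul0r // ltW.
    by rewrite [X in _ * X]L0 ?mulr0 //; lra.
  move=> /closure_subset; rewrite (_ : closure `[delta / 4, 1 - delta / 4] = `[delta / 4, 1 - delta / 4]%classic); last first.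
    by apply/esym/closure_id; exact: interval_closed.
  move=> /subset_trans; apply => x /=; rewrite !in_itv /= => /andP[h1 h2]; apply/andP; split; lra.
- move=> x /andP[h1 h2]; have L1 y : delta / 2 < y -> L y = 1.
    move=> yd; apply: smoothstep1; rewrite lerBrDr mulrAC ler_pdivlMr //; lra.
  by rewrite !L1 ?mulr1 //; lra.
Qed.

End BumpFunction.

(** * Mean of the Ito integral *)

Section NormalLaw.
Context {R : realType}.
Local Notation mu := (@lebesgue_measure R).
Variable s : R.
Hypothesis s0 : s != 0.

(** Change of variables by the Radon-Nikodym derivative of the normal law, which agrees a.e. with
    [normal_pdf] because both have the same integrals over measurable sets. *)
Lemma ge0_integral_normal_prob (h : R -> R) : (forall x, 0 <= h x) ->
  measurable_fun [set: R] h ->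
  (\int[normal_prob 0 s]_x (h x)%:E = \int[mu]_x (h x * normal_pdf 0 s x)%:E)%E.
Proof.
move=> h0 mh; have dom := normal_prob_dominates 0 s.
rewrite -(Radon_Nikodym_SigmaFinite.change_of_variables dom) //; last exact/measurable_EFinP.
under [RHS]eq_integral do rewrite EFinM.
have intRN := Radon_Nikodym_SigmaFinite.f_integrable dom.
have mpdf : measurable_fun [set: R] (fun x => (normal_pdf 0 s x)%:E).
  by apply/measurable_EFinP; exact: measurable_normal_pdf.
apply: ae_eq_integral => //.
- apply: emeasurable_funM; first exact/measurable_EFinP.
  exact: (measurable_int _ intRN).
- by apply: emeasurable_funM => //; exact/measurable_EFinP.
- apply: ae_eqe_mul2l; apply: integral_ae_eq => // E _ mE.
  by rewrite -(Radon_Nikodym_SigmaFinite.f_integral dom).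
Qed.

(** Instead of computing the moment, |x| times the density is dominated by a multiple of the density
    with doubled deviation, whose integral is 1. The ratio of the two exponentials is exp(u) with u
    = 3 x^2 / (8 s^2), and |x| <= 1 + x^2 <= (1 + 8 s^2 / 3) exp(u). *)
Lemma normal_first_moment_lty :
  (\int[mu]_x (`|x| * normal_pdf 0 s x)%:E < +oo)%E.
Proof.
have s20 : 2 * s != 0 by rewrite mulf_neq0 // pnatr_eq0.
pose C := (1 + 8 * s ^+ 2 / 3) * normal_peak s / normal_peak (2 * s).
have C0 : 0 <= C.
  rewrite divr_ge0 ?normal_peak_ge0 // mulr_ge0 ?normal_peak_ge0 //.
  by have := sqr_ge0 s; lra.
have le x : `|x| * normal_pdf 0 s x <= C * normal_pdf 0 (2 * s) x.
  rewrite !normal_pdfE // /C mulrCA -[leRHS]mulrA mulKf ?gt_eqF ?normal_peak_gt0 //.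
  rewrite [leRHS]mulrAC mulrC ler_wpM2r ?normal_peak_ge0 //.
  pose u := 3 * x ^+ 2 / (8 * s ^+ 2).
  have s2 : 0 < s ^+ 2 by rewrite exprn_even_gt0.
  have -> : normal_fun 0 (2 * s) x = normal_fun 0 s x * expR u.
    rewrite /normal_fun -expRD; congr expR; rewrite /u; field.
    by rewrite ?s0.
  rewrite mulrC [leRHS]mulrCA ler_wpM2l ?normal_fun_ge0 //.
  have -> : `|x| = Num.sqrt (x ^+ 2) by rewrite sqrtr_sqr.
  have eu := expR_ge1Dx u; have u0 : 0 <= u by rewrite divr_ge0 // mulr_ge0 // sqr_ge0.
  have xu : x ^+ 2 = 8 * s ^+ 2 / 3 * u by rewrite /u; field.
  rewrite sqrtr_sqr; apply: (@le_trans _ _ (1 + x ^+ 2)).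
    have := sqr_ge0 (`|x| - 1); rewrite sqrrB real_normK ?num_real //; have := normr_ge0 x; nra.
  set q := 8 * s ^+ 2 / 3 in xu *; have q0 : 0 <= q by rewrite /q; lra.
  have qu := mulr_ge0 q0 u0.
  rewrite xu; apply: (@le_trans _ _ ((1 + q) * (1 + u))); first lra.
  by rewrite ler_wpM2l // addr_ge0.
apply: (@le_lt_trans _ _ (\int[mu]_x (C%:E * (normal_pdf 0 (2 * s) x)%:E))%E).
  apply: ge0_le_integral => //.
  - by move=> x _; rewrite lee_fin mulr_ge0 ?normal_pdf_ge0.
  - apply/measurable_EFinP/measurable_funM; last exact: measurable_normal_pdf.
    exact: normr_measurable.
  - by apply/measurable_EFinP/measurable_funM => //; exact: measurable_normal_pdf.
  - by move=> x _; rewrite -EFinM lee_fin.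
rewrite ge0_integralZl //.
- by rewrite integral_normal_pdf mule1 ltry.
- by apply/measurable_EFinP; exact: measurable_normal_pdf.
- by move=> x _; rewrite lee_fin normal_pdf_ge0.
Qed.

Lemma normal_half_moments :
  (\int[mu]_x (Num.max (- x) 0 * normal_pdf 0 s x)%:E =
   \int[mu]_x (Num.max x 0 * normal_pdf 0 s x)%:E)%E.
Proof.
pose h x := (Num.max x 0 * normal_pdf 0 s x)%:E.
have mh : measurable_fun [set: R] h.
  apply/measurable_EFinP/measurable_funM; last exact: measurable_normal_pdf.
  exact: measurable_maxr.
transitivity (\int[pushforward mu (-%R : _ -> measurableTypeR R)]_x h x)%E; last first.
  by apply: eq_measure_integral => A mA _; exact: lebesgue_measureN.
have h0 x : (0 <= h x)%E.
  by rewrite lee_fin mulr_ge0 ?normal_pdf_ge0 // le_max lexx orbT.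
have mN : measurable_fun [set: measurableTypeR R] (-%R : _ -> measurableTypeR R).
  by [].
rewrite (@ge0_integral_pushforward _ _ (measurableTypeR R) (measurableTypeR R) R -%R
  mN mu setT h measurableT mh (fun y _ => h0 y)).
rewrite preimage_setT; apply: eq_integral => x _.
by rewrite /h /= !normal_pdfE // /normal_fun !subr0 sqrrN.
Qed.

Section RandomVariable.
Context d (T : measurableType d) (P : probability T R) (X : T -> R).
Hypothesis mX : measurable_fun [set: T] X.
Hypothesis lawX : forall A, measurable A -> P (X @^-1` A) = normal_prob 0 s A.

Lemma ge0_integral_normal_law (h : R -> R) : (forall x, 0 <= h x) ->
  measurable_fun [set: R] h ->
  (\int[P]_w (h (X w))%:E = \int[mu]_x (h x * normal_pdf 0 s x)%:E)%E.
Proof.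
move=> h0 mh; rewrite -ge0_integral_normal_prob //.
have /esym := @ge0_integral_pushforward _ _ T (measurableTypeR R) R X mX P setT (EFin \o h)
  measurableT ((measurable_EFinP _ _).2 mh) (fun y _ => h0 y).
by rewrite preimage_setT => ->; apply: eq_measure_integral => A mA _; exact: lawX.
Qed.

Lemma integrable_normal_law : P.-integrable [set: T] (EFin \o X).
Proof.
apply/integrableP; split; first exact/measurable_EFinP.
rewrite (_ : (\int[P]_x _)%E = (\int[P]_w (`|X w|)%:E)%E) //.
by rewrite (@ge0_integral_normal_law Num.norm) //; exact: normal_first_moment_lty.
Qed.

Lemma integral_normal_law : (\int[P]_w (X w)%:E = 0)%E.
Proof.
rewrite integralE.
have -> : (\int[P]_x ((fun w => (X w)%:E)^\+ x))%E = (\int[P]_w (Num.max (X w) 0)%:E)%E.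
  by apply: eq_integral => w _; rewrite funeposE EFin_max.
have -> : (\int[P]_x ((fun w => (X w)%:E)^\- x))%E = (\int[P]_w (Num.max (- X w) 0)%:E)%E.
  by apply: eq_integral => w _; rewrite funenegE EFin_max EFinN.
have m0 (x : R) : 0 <= Num.max x 0 by rewrite le_max lexx orbT.
rewrite (@ge0_integral_normal_law (fun x => Num.max x 0)) //; last exact: measurable_maxr.
rewrite (@ge0_integral_normal_law (fun x => Num.max (- x) 0)) //; last first.
  by apply: measurable_maxr => //; exact: measurable_funN.
rewrite normal_half_moments subee // ge0_fin_numE; last first.
  by apply: integral_ge0 => x _; rewrite lee_fin mulr_ge0 ?normal_pdf_ge0.
apply: le_lt_trans normal_first_moment_lty; apply: ge0_le_integral => //.
- by move=> x _; rewrite lee_fin mulr_ge0 ?normal_pdf_ge0.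
- apply/measurable_EFinP/measurable_funM; last exact: measurable_normal_pdf.
  exact: measurable_maxr.
- apply/measurable_EFinP/measurable_funM; last exact: measurable_normal_pdf.
  exact: normr_measurable.
- move=> x _; rewrite lee_fin ler_wpM2r ?normal_pdf_ge0 //.
  by rewrite ge_max normr_ge0 ler_norm.
Qed.

End RandomVariable.
End NormalLaw.

Section ItoMean.
Context {R : realType} {d : measure_display} {T : measurableType d}.
Variables (P : probability T R) (W : R -> T -> R).
Hypothesis BW : brownian_motion P W.

Lemma increment_mean (a b : R) : 0 <= a -> a <= b -> b <= 1 ->
  P.-integrable [set: T] (EFin \o increment W a b) /\
  \int[P]_w increment W a b w = 0.
Proof.
move=> a0 ab b1; have [mW _ _ lawW _] := BW.
have mI : measurable_fun [set: T] (increment W a b).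
  by apply: measurable_funB; apply: mW; rewrite in_itv /=; apply/andP; split => //; lra.
(* Partition points of a step integrand may coincide, while the Gaussian law is postulated for a < b
   only. *)
have [->|nab] := eqVneq a b.
  rewrite (_ : increment W b b = cst 0); last by apply/funext => w; rewrite /increment subrr.
  by split; [exact: integrable0|rewrite Rintegral_cst // mul0r].
have lab : a < b by rewrite lt_neqAle nab.
have s0 : Num.sqrt (b - a) != 0 by rewrite gt_eqF // sqrtr_gt0 subr_gt0.
have law A : measurable A -> P (increment W a b @^-1` A) = normal_prob 0 (Num.sqrt (b - a)) A.
  exact: lawW.
split; first exact: integrable_normal_law s0 _ _ _ _ mI law.
by rewrite /Rintegral (integral_normal_law s0 mI law).
Qed.

Lemma step_pt_mono (s : @step_integrand R) i j : (i <= j <= step_size s)%N ->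
  step_pt s i <= step_pt s j.
Proof.
elim: j => [|j IH] /andP[].
  by rewrite leqn0 => /eqP ->.
rewrite leq_eqVlt => /orP[/eqP -> //|ij] js.
by apply: (le_trans (IH _)); [rewrite -ltnS ij ltnW|exact: step_pt_le].
Qed.

Lemma step_ito_mean (s : @step_integrand R) :
  P.-integrable [set: T] (EFin \o step_ito W s) /\
  \int[P]_w step_ito W s w = 0.
Proof.
have h (i : 'I_(step_size s)) := @increment_mean (step_pt s i) (step_pt s i.+1).
have b0 (i : 'I_(step_size s)) : 0 <= step_pt s i.
  by rewrite -(step_pt0 s) step_pt_mono //= ltnW.
have b1 (i : 'I_(step_size s)) : step_pt s i.+1 <= 1.
  by rewrite -(step_pt1 s) step_pt_mono //= ltn_ord leqnn.
have bb (i : 'I_(step_size s)) : step_pt s i <= step_pt s i.+1 by exact: step_pt_le.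
have hi (i : 'I_(step_size s)) : P.-integrable [set: T]
    (EFin \o (fun w => step_coef s i * increment W (step_pt s i) (step_pt s i.+1) w)).
  exact: (integrableZl measurableT (step_coef s i) (h i (b0 i) (bb i) (b1 i)).1).
split.
  have := @integrable_sum _ _ _ P _ measurableT _ (index_enum _) xpredT _ (fun i _ => hi i).
  by apply: eq_integrable => // x _ /=; rewrite sumEFin.
rewrite /step_ito (Rintegral_sum measurableT) //.
rewrite big1 // => i _; rewrite RintegralZl //; last exact: (h i _ _ _).1.
by rewrite (h i _ _ _).2 // mulr0.
Qed.

(** On a probability space the mean of |X| is at most the square root of the mean of X^2, so L^2
    convergence of the elementary integrals, all of mean zero, passes integrability and the mean to
    the limit. *)
Lemma ito_integral_mean (g : R -> R) (I : T -> R) : is_ito_integral P W g I ->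
  P.-integrable [set: T] (EFin \o I) /\ \int[P]_w I w = 0.
Proof.
move=> [_ mI [s [_ cvs]]].
have P1 : P [set: T] = 1%E by exact: probability_setT.
have close (e : R) : 0 < e -> exists k, L2 P [set: T] (fun w => I w - step_ito W (s k) w) /\
   \int[P]_w (I w - step_ito W (s k) w) ^+ 2 <= e ^+ 2.
  move=> e0; have e20 : 0 < e ^+ 2 by rewrite exprn_gt0.
  have n0 : nbhs (0%:E : \bar R) [set y | (y < (e ^+ 2)%:E)%E].
    exact: (@nbhs_open_ereal_lt _ 0 (fun=> e ^+ 2) e20).
  have [k _ Hk] := cvs _ n0; exists k.
  have := Hk k (leqnn k) => /= lte.
  have mJ : measurable_fun [set: T] (fun w => I w - step_ito W (s k) w).
    by apply: measurable_funB => //; have /measurable_int/measurable_EFinP := (step_ito_mean (s k)).1.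
  have J2 : P.-integrable [set: T] (EFin \o (fun w => (I w - step_ito W (s k) w) ^+ 2)).
    apply/integrableP; split; first exact/measurable_EFinP/measurable_funX.
    under eq_integral do rewrite gee0_abs ?lee_fin ?sqr_ge0 //.
    by apply: (lt_trans lte); rewrite ltry.
  split; first by split.
  by rewrite -lee_fin fineK ?ltW //; exact: integrable_fin_num.
have split_int e (e0 : 0 < e) : P.-integrable [set: T] (EFin \o I) /\ `|\int[P]_w I w| <= e.
  have [k [LJ J2]] := close e e0; have [is_ ms] := step_ito_mean (s k).
  have iJ := L2_integrable measurableT P1 LJ.
  have iI : P.-integrable [set: T] (EFin \o I).
    have := integrableD measurableT iJ is_; apply: eq_integrable => // w _ /=.
    by rewrite -EFinD subrK.
  split=> //.
  have -> : \int[P]_w I w = \int[P]_w (I w - step_ito W (s k) w) by rewrite RintegralB // ms subr0.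
  apply: (le_trans (le_normr_Rintegral measurableT iJ)).
  rewrite -(@ler_pXn2r _ 2%N) ?nnegrE //; [|by apply: Rintegral_ge0|exact: ltW].
  exact: le_trans (sqr_Rintegral_norm_le measurableT P1 LJ) J2.
split; first exact: (split_int 1 ltr01).1.
apply/eqP; rewrite -normr_le0; apply/ler_addgt0Pr => e e0; rewrite add0r.
exact: (split_int e e0).2.
Qed.

End ItoMean.

(** * Sources and their sine coefficients *)

Section Sources.
Context {R : realType}.
Local Notation mu := (@lebesgue_measure R).
Local Notation D := (`]0, 1[%classic : set R).
Local Notation "'Int' f" := (\int[mu]_(x in `]0, 1[) f x) (at level 10, f at level 8).
Implicit Types (f g phi : R -> R) (n k j K : nat) (M c x y kappa : R).

Let mD := @measurable_unit_itv R.
Let muD := @measure_unit_itv R.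

Definition sine_transform f kappa : R := Int (fun y => f y * sin (kappa * y)).

(** The endpoints lie outside the support, so each has a neighbourhood in which f vanishes a.e.; [e]
    is the smaller radius. *)
Lemma source_vanishes_near_boundary n M f : source_class n M f ->
  exists2 e : R, 0 < e & {ae mu, forall y, y \in `]0, 1[ ->
    ~~ (e <= y <= 1 - e) -> f y = 0}.
Proof.
move=> [_ _ _ sup].
have away x : x \notin (`]0, 1[ : interval R) -> exists2 e : R, 0 < e &
    {ae mu, forall y, y \in `]0, 1[ -> `|y - x| < e -> f y = 0}.
  move=> /negP xI; have [//|H] := pselect (exists2 e : R, 0 < e &
    {ae mu, forall y, y \in `]0, 1[ -> `|y - x| < e -> f y = 0}).
  by exfalso; apply: xI; apply: sup => e e0 A; apply: H; exists e.
have [|e0 e0p h0] := away 0; first by rewrite in_itv /= ltxx.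
have [|e1 e1p h1] := away 1; first by rewrite in_itv /= ltxx andbF.
exists (Num.min e0 e1); first by rewrite lt_min e0p.
apply: (@filterS2 _ _ (ae_filter_ringOfSetsType mu) _ _ _ _ h0 h1) => y a0 a1 yI; have := yI; rewrite in_itv /= => /andP[y0 y1].
rewrite negb_and -!ltNge => /orP[|] h.
  by apply: a0 => //; rewrite subr0 gtr0_norm // (lt_le_trans h) // ge_min lexx.
apply: a1 => //; rewrite distrC gtr0_norm ?subr_gt0 //.
by apply: (@lt_le_trans _ _ (Num.min e0 e1)); [lra|rewrite ge_min lexx orbT].
Qed.

(** Membership in the Sobolev space makes the choice by [get] a genuine weak derivative, and its
    squared norm is one summand of the squared Sobolev norm. For k = 0 it stands in for [f], whose
    own [L2norm] does not occur in [sobolev_norm]. *)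
Lemma weak_derivative_bound n M f k : 0 <= M -> source_class n M f -> (k <= n)%N ->
  [/\ L2 mu D (weak_derivative k f), is_weak_derivative k f (weak_derivative k f) &
      Int (fun x => weak_derivative k f x ^+ 2) <= M ^+ 2].
Proof.
move=> M0 [[_ wf] nf _ _] kn.
have [g Hg] := wf k kn.
have [Lg wg] : (sq_integrable (weak_derivative k f) /\ is_weak_derivative k f (weak_derivative k f)).
  exact: (@getPex _ [set g | sq_integrable g /\ is_weak_derivative k f g] (ex_intro _ g Hg)).
split => //.
have i0 : 0 <= Int (fun x => weak_derivative k f x ^+ 2) by apply: Rintegral_ge0 => x _; exact: sqr_ge0.
have -> : Int (fun x => weak_derivative k f x ^+ 2) = L2norm (weak_derivative k f) ^+ 2.
  by rewrite /L2norm sqr_sqrtr.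
apply: (@le_trans _ _ (\sum_(k < n.+1) L2norm (weak_derivative k f) ^+ 2)).
  rewrite (bigD1 (Ordinal (kn : (k < n.+1)%N))) //= lerDl.
  by apply: sumr_ge0 => i _; exact: sqr_ge0.
rewrite -[leLHS]sqr_sqrtr; last by apply: sumr_ge0 => i _; exact: sqr_ge0.
by rewrite lerXn2r ?nnegrE ?sqrtr_ge0.
Qed.

Lemma ae_eq_RintegralM f g h : L2 mu D f -> continuous g -> continuous h ->
  {ae mu, forall y, y \in `]0, 1[ -> f y * g y = f y * h y} ->
  Int (fun y => f y * g y) = Int (fun y => f y * h y).
Proof.
move=> [mf _] cg ch ae; congr fine; apply: ae_eq_integral => //.
- apply/measurable_EFinP/measurable_funM => //.
  by apply: measurable_funTS; exact: continuous_measurable_fun.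
- apply/measurable_EFinP/measurable_funM => //.
  by apply: measurable_funTS; exact: continuous_measurable_fun.
- by apply: (@filterS _ _ (ae_filter_ringOfSetsType mu) _ _ _ ae) => y h1 Dy; rewrite h1.
Qed.

(* The cutoff turns [phi] into a test function without changing the pairing,
   because [f] vanishes near the endpoints. *)
Lemma source_pairing n M f k phi c : 0 <= M -> source_class n M f -> (k <= n)%N ->
  smooth phi -> (forall x, 0 < x < 1 -> `|phi x| <= c) ->
  `|Int (fun y => f y * derive1n k phi y)| <= M * c.
Proof.
move=> M0 src kn sphi phic.
have [e e0 fe] := source_vanishes_near_boundary src.
have [Lg wg gM] := weak_derivative_bound M0 src kn.
have [chi [schi chi01 supchi chi1]] := exists_cutoff e0.
pose psi x := chi x * phi x.
have spsi : smooth psi by move=> m; apply: smoothnM; [exact: schi|exact: sphi].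
have tpsi : test_function psi.
  split; first by move=> m x; exact: smooth_derivable.
  apply: subset_trans supchi; apply: closure_subset => x /=.
  by apply: contra_neq => c0; rewrite /psi c0 mul0r.
have Lf : L2 mu D f by case: src => -[].
have loc : {in `]e / 2, 1 - e / 2[%classic, derive1n k psi =1 derive1n k phi}.
  apply: derive1n_local; first exact: interval_open.
  by move=> x; rewrite inE /= in_itv /= => h; rewrite /psi chi1 // mul1r.
have -> : Int (fun y => f y * derive1n k phi y) = Int (fun y => f y * derive1n k psi y).
  apply: ae_eq_RintegralM => //; [exact: continuous_derive1n|exact: continuous_derive1n|].
  apply: (@filterS _ _ (ae_filter_ringOfSetsType mu) _ _ _ fe) => y fy yI; have [h|h] := boolP (e <= y <= 1 - e); last by rewrite fy // !mul0r.
  by rewrite loc // inE /= in_itv /=; case/andP: h => ? ?; apply/andP; split; lra.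
rewrite (wg psi tpsi) normrM normrX normrN1 expr1n mul1r.
apply: (@normr_RintegralM_le _ _ _ mu D mD muD _ psi c M Lg) => //.
  by apply: measurable_funTS; apply: continuous_measurable_fun; exact: (@continuous_derive1n _ psi 0 spsi).
move=> x /=; rewrite in_itv /= => x01; have /andP[h0 h1] := chi01 x.
rewrite /psi normrM (ger0_norm h0); apply: le_trans (phic x x01).
by rewrite ler_piMl.
Qed.

Lemma source_sine_decay n M f j : 0 <= M -> source_class n M f -> (0 < j)%N ->
  `|sine_transform f (j%:R * pi)| <= M / j%:R ^+ n.
Proof.
move=> M0 src j0; set a := j%:R * pi.
have j1 : 1 <= j%:R :> R by rewrite ler1n.
have aj : j%:R <= a.
  rewrite ler_peMr //; apply: le_trans (pi_ge2 R); lra.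
have a0 : 0 < a by apply: lt_le_trans aj; rewrite ltr0n.
(* The phase is chosen so that the n-th derivative is exactly a^n sin(a y). *)
pose phi y := sin (a * y + - (n%:R * (pi / 2))).
have := @source_pairing n M f n phi 1 M0 src (leqnn n) (smooth_sin_affine _ _) (fun x _ => sin_max _).
have -> : Int (fun y => f y * derive1n n phi y) = a ^+ n * sine_transform f a.
  rewrite /sine_transform -RintegralZl //; last first.
    apply: (@L2M _ _ _ mu D mD _ _ _ (@continuous_L2 _ _ 1 (@continuous_sinl _ a) (fun x => sin_max _))).
    by case: src => -[].
  by apply: eq_Rintegral => y _; rewrite /phi derive1n_sin_affine addNr addr0; ring.
rewrite normrM mulr1 normrX (gtr0_norm a0) => h.
apply: (@le_trans _ _ (M / a ^+ n)); first by rewrite ler_pdivlMr ?exprn_gt0 // mulrC.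
rewrite ler_wpM2l // lef_pV2 ?posrE ?exprn_gt0 // ?ltr0n //.
by rewrite lerXn2r ?nnegrE // ltW.
Qed.

Lemma sine_transform_sum f m (w t : 'I_m -> R) : L2 mu D f ->
  Int (fun y => f y * \sum_(i < m) w i * sin (t i * y)) =
  \sum_(i < m) w i * sine_transform f (t i).
Proof.
move=> Lf.
have ii (i : 'I_m) : mu.-integrable D (EFin \o (fun y => f y * sin (t i * y))).
  exact: (@L2M _ _ _ mu D mD _ _ Lf (@continuous_L2 _ _ 1 (@continuous_sinl _ (t i)) (fun x => sin_max _))).
under [RHS]eq_bigr do rewrite /sine_transform -RintegralZl //.
rewrite -(Rintegral_sum mD) => [|i]; last exact: (integrableZl mD (w i) (ii i)).
by apply: eq_Rintegral => y _; rewrite mulr_sumr; apply: eq_bigr => i _; ring.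
Qed.

(** The extrapolation error is itself smooth and bounded by [c] on (0,1), so the pairing of order 0
    applies to it. *)
Lemma source_extrapolation n M f kappa m (w t : 'I_m -> R) c : 0 <= M -> source_class n M f ->
  (forall y, 0 <= y <= 1 ->
      `|sin (kappa * y) - \sum_(i < m) w i * sin (t i * y)| <= c) ->
  `|sine_transform f kappa - \sum_(i < m) w i * sine_transform f (t i)| <= M * c.
Proof.
move=> M0 src H; have Lf : L2 mu D f by case: src => -[].
pose phi y := sin (kappa * y + 0) + \sum_(i < m) w i * - sin (t i * y + 0).
have phiE y : phi y = sin (kappa * y) - \sum_(i < m) w i * sin (t i * y).
  rewrite /phi addr0 -sumrN; congr (_ + _); apply: eq_bigr => i _.
  by rewrite addr0 mulrN.
have sphi : smooth phi.
  move=> k; apply: smoothnD; first exact: smooth_sin_affine.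
  apply: (@smooth_sum _ _ _ (fun i y => w i * - sin (t i * y + 0))) => i l.
  by apply: smoothnZ; under eq_fun do rewrite -mulN1r; apply: smoothnZ; exact: smooth_sin_affine.
have := @source_pairing n M f 0 phi c M0 src (leq0n n) sphi.
have -> : Int (fun y => f y * derive1n 0 phi y) =
   sine_transform f kappa - \sum_(i < m) w i * sine_transform f (t i).
  rewrite -sine_transform_sum // /sine_transform -RintegralB //.
  - by apply: eq_Rintegral => y _; rewrite derive1n0 phiE mulrBr.
  - exact: (@L2M _ _ _ mu D mD _ _ Lf (@continuous_L2 _ _ 1 (@continuous_sinl _ kappa) (fun x => sin_max _))).
  - apply: (@L2M _ _ _ mu D mD _ _ Lf); apply: (@L2_sum _ _ _ mu D mD muD) => i.
    apply: (L2Z mD); exact: (@continuous_L2 _ _ 1 (@continuous_sinl _ (t i)) (fun x => sin_max _)).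
by apply => x /andP[x0 x1]; rewrite phiE; apply: H; rewrite !ltW.
Qed.

End Sources.

(** * Estimates on the sine coefficients *)

Section SineCoefficients.
Context {R : realType}.
Implicit Types (n N K j p : nat) (M A eps : R).

Lemma fact_succ_le_exp p : (p.+1`! <= p.+1 ^ p)%N.
Proof.
elim: p => [//|p IH]; rewrite factS expnS leq_mul2l /=.
by apply: leq_trans IH _; case: p => // p; rewrite leq_exp2r.
Qed.

(** For j > K, j^(-p-1) is at most K^(1-p) / (j (j - 1)), and 1 / (j (j - 1)) telescopes to at most
    1 / K. *)
Lemma sum_inv_exprn_tail p K L : (0 < p)%N -> (0 < K)%N ->
  \sum_(K.+1 <= j < L) (j%:R ^+ p.+1)^-1 <= (K%:R ^+ p)^-1 :> R.
Proof.
move=> p0 K0; have [KL|LK] := leqP K.+1 L; last first.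
  by rewrite big_geq ?invr_ge0 ?exprn_ge0 // ltnW.
apply: (@le_trans _ _ ((K%:R ^+ p.-1)^-1 * \sum_(K.+1 <= j < L) (j.-1%:R^-1 - j%:R^-1))).
  rewrite mulr_sumr; apply: ler_sum_nat => j /andP[Kj _].
  have j0 : 0 < j%:R :> R by rewrite ltr0n (leq_ltn_trans _ Kj).
  have jK : K%:R <= j.-1%:R :> R by rewrite ler_nat -ltnS prednK // (leq_ltn_trans _ Kj).
  have K0' : 0 < K%:R :> R by rewrite ltr0n.
  have jp0 : 0 < j.-1%:R :> R by exact: lt_le_trans jK.
  have jE : j%:R = j.-1%:R + 1 :> R by rewrite natr1 prednK // (leq_ltn_trans _ Kj).
  have -> : j.-1%:R^-1 - j%:R^-1 = (j%:R * j.-1%:R)^-1 :> R.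
    by rewrite jE; field; rewrite -jE !gt_eqF.
  rewrite -[in p.+1](prednK p0) !exprS -invfM lef_pV2 ?posrE ?mulr_gt0 ?exprn_gt0 //.
  have -> : j%:R * (j%:R * j%:R ^+ p.-1) = j%:R ^+ p.-1 * (j%:R * j%:R) :> R by ring.
  apply: ler_pM; first exact/exprn_ge0/ltW.
  - by rewrite mulr_ge0 ?ltW.
  - by rewrite lerXn2r ?nnegrE ?(ltW K0') ?(ltW j0) //; lra.
  - by rewrite ler_pM2l //; lra.
have -> : \sum_(K.+1 <= j < L) (j.-1%:R^-1 - j%:R^-1) = K%:R^-1 - L.-1%:R^-1 :> R.
  rewrite -(prednK (leq_trans (ltn0Sn K) KL)) big_add1 /=.
  under eq_bigr do rewrite -opprB.
  have := @telescope_sumr R K L.-1 (fun j => j%:R^-1).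
  rewrite -ltnS prednK ?(leq_trans (ltn0Sn K) KL) // sumrN => /(_ KL) ->.
  by rewrite opprB.
rewrite -[in leRHS](prednK p0) exprSr invfM ler_wpM2l ?invr_ge0 ?exprn_ge0 //.
by rewrite gerBl invr_ge0.
Qed.

(* [6 n - 3 = 3 p] with [p = 2 n - 1]. *)
Lemma factor_absorbs_factorial p : (0 < p)%N ->
  2 ^+ p * (p.+1`!)%:R <= ((3 * p%:R) ^+ 3) ^+ p :> R.
Proof.
move=> p0; have p1 : 1 <= p%:R :> R by rewrite ler1n.
apply: (@le_trans _ _ (2 ^+ p * p.+1%:R ^+ p)).
  by rewrite ler_wpM2l ?exprn_ge0 // -natrX ler_nat fact_succ_le_exp.
rewrite -exprMn lerXn2r ?nnegrE ?exprn_ge0 ?mulr_ge0 //.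
have p2 : 1 <= p%:R ^+ 2 :> R by rewrite exprn_ege1.
have p3 : p%:R <= p%:R ^+ 3 :> R by rewrite exprS ler_peMr.
rewrite -natr1 exprMn.
have -> : 3 ^+ 3 = 27 :> R by rewrite -natrX.
lra.
Qed.

(** Since k <= k^2, it suffices to bound (c + 1) k^2: by (c + 1)^3 when k <= c + 1, and by k^3
    otherwise. *)
Lemma cubic_dominates (c k : R) : 0 <= c -> 1 <= k ->
  c * k ^+ 2 + - k ^+ 3 <= (c + 1) ^+ 3 + - k.
Proof.
move=> c0 k1; have k0 : 0 <= k by exact: le_trans k1.
have c1 : 0 <= c + 1 by rewrite addr_ge0.
have k2 : k <= k ^+ 2 by rewrite expr2 ler_peMr.
have k3 : 0 <= k ^+ 3 by rewrite exprn_ge0.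
have c3 : 0 <= (c + 1) ^+ 3 by rewrite exprn_ge0.
suff : c * k ^+ 2 + k ^+ 2 <= (c + 1) ^+ 3 + k ^+ 3.
  move: (k ^+ 2) (k ^+ 3) k2 ((c + 1) ^+ 3) => q r qk z h; lra.
rewrite -[X in _ + X <= _]mul1r -mulrDl; have [h|h] := leP k (c + 1).
  apply: ler_wpDr => //; rewrite [leRHS]exprS ler_wpM2l // lerXn2r ?nnegrE //.
by apply: ler_wpDl => //; rewrite [leRHS]exprS ler_wpM2r ?sqr_ge0 // ltW.
Qed.

Section Bounds.
(** To be instantiated with s j = S(j pi) for the difference of the two sources, [A] its squared
    norm and [eps] = eps4. The factors 2 and 34 = 2 times 17 count one contribution from each
    source. *)
Variables (s : nat -> R) (n N : nat) (M A eps : R).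
Hypotheses (n0 : (0 < n)%N) (N0 : (0 < N)%N) (M1 : 1 < M) (eps0 : 0 <= eps).
Hypothesis parseval : forall eta, 0 < eta -> exists K0, forall K, (K0 <= K)%N ->
  A <= eta + 2 * \sum_(j < K) s j ^+ 2.
Hypothesis s0 : s 0%N = 0.
Hypothesis decay : forall j, (0 < j)%N -> `|s j| <= 2 * M / j%:R ^+ n.
Hypothesis extrapolation : forall K j, (0 < j <= K)%N ->
  `|s j| <= expR (1200 * K%:R ^+ 2) * eps + 34 * M * expR (- K%:R).

Let p := (2 * n - 1)%N.
Let p0 : (0 < p)%N. Proof. by rewrite /p; case: (n) n0 => // k _; rewrite mulnS subn1. Qed.
Let pS : p.+1 = (2 * n)%N. Proof. by rewrite /p subn1 prednK // muln_gt0. Qed.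
Let M0 : 0 < M. Proof. by apply: lt_trans M1. Qed.

Let partial K := \sum_(1 <= j < K.+1) s j ^+ 2.

(** Parseval's sum is cut at K. The squared decay 4 M^2 / j^(2n) sums beyond K to at most 4 M^2 /
    K^p, because 2 n = p + 1, and Parseval doubles it. *)
Lemma energy_le_partial_sum K : (0 < K)%N -> A <= 2 * partial K + 8 * M ^+ 2 / K%:R ^+ p.
Proof.
move=> K0; apply/ler_addgt0Pr => eta eta0.
have [K1 /(_ (maxn K1 K.+1) (leq_maxl _ _)) H] := parseval eta0.
set L := maxn K1 K.+1 in H; have KL : (K.+1 <= L)%N by exact: leq_maxr.
apply: (le_trans H); rewrite [leRHS]addrC; apply: lerD => //.
rewrite -(big_mkord xpredT (fun j => s j ^+ 2)) big_ltn ?(leq_trans _ KL) // s0 expr0n add0r.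
rewrite (@big_cat_nat _ _ _ K.+1) //= mulrDr lerD2l.
have -> : 8 * M ^+ 2 / K%:R ^+ p = 2 * (4 * M ^+ 2 * (K%:R ^+ p)^-1) by ring.
rewrite ler_wpM2l //.
apply: (@le_trans _ _ (\sum_(K.+1 <= j < L) 4 * M ^+ 2 * (j%:R ^+ p.+1)^-1)).
  apply: ler_sum_nat => j /andP[Kj _]; have j0 : (0 < j)%N by exact: leq_ltn_trans Kj.
  have jp : 0 < j%:R ^+ n :> R by rewrite exprn_gt0 // ltr0n.
  rewrite -(real_normK (num_real (s j))) pS mulnC exprM.
  have -> : 4 * M ^+ 2 * (j%:R ^+ n ^+ 2)^-1 = (2 * M / j%:R ^+ n) ^+ 2.
    by rewrite !exprMn exprVn; ring.
  by rewrite lerXn2r ?nnegrE ?decay // divr_ge0 ?mulr_ge0 ?ltW.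
by rewrite -mulr_sumr ler_wpM2l ?sum_inv_exprn_tail // mulr_ge0 ?sqr_ge0.
Qed.

(** exp(1201^3) bounds exp(1200 K^2 - K^3 + K) for all K >= 1; 34 is the coefficient of the
    extrapolation error. *)
Definition extrapolation_constant : R := expR ((1200 + 1) ^+ 3) + 34.
Local Notation B := extrapolation_constant.

Lemma extrapolation_constant_ge34 : 34 <= B.
Proof. by rewrite lerDr expR_ge0. Qed.

Lemma coefficient_small K j : (0 < j <= K)%N -> eps <= expR (- K%:R ^+ 3) ->
  `|s j| <= B * M * expR (- K%:R).
Proof.
move=> jK e; apply: (le_trans (extrapolation jK)).
have -> : B * M * expR (- K%:R) =
    expR ((1200 + 1) ^+ 3) * M * expR (- K%:R) + 34 * M * expR (- K%:R).
  by rewrite /extrapolation_constant; move: (expR (_ ^+ 3)) => q; ring.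
rewrite lerD2r.
apply: (@le_trans _ _ (expR (1200 * K%:R ^+ 2) * expR (- K%:R ^+ 3))).
  by rewrite ler_wpM2l ?expR_ge0.
apply: (@le_trans _ _ (expR ((1200 + 1) ^+ 3) * expR (- K%:R))); last first.
  by rewrite ler_wpM2r ?expR_ge0 // ler_peMr ?expR_ge0 // ltW.
rewrite -!expRD ler_expR.
have K1 : 1 <= K%:R :> R by rewrite ler1n; case/andP: jK => j1 /(leq_trans j1).
have c0 : 0 <= 1200 :> R := ler0n _ _.
exact (cubic_dominates c0 K1).
Qed.

(** At most K coefficients lie between N and K, each at most B M exp(-K). Their squares are traded
    for a power of K by K^(p+1) <= (p+1)! exp(K), which gives them the same shape as the tail beyond
    K. *)
Lemma energy_le_low_frequencies K : (N <= K)%N -> eps <= expR (- K%:R ^+ 3) ->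
  A <= 2 * partial N + (2 * B ^+ 2 + 8) * (p.+1`!)%:R * M ^+ 2 / K%:R ^+ p.
Proof.
move=> NK e; have K0 : (0 < K)%N by exact: leq_trans NK.
apply: (le_trans (energy_le_partial_sum K0)).
have kp : 0 < K%:R ^+ p :> R by rewrite exprn_gt0 // ltr0n.
rewrite /partial (@big_cat_nat _ _ _ N.+1) //= mulrDr -addrA lerD2l.
have : \sum_(N.+1 <= j < K.+1) s j ^+ 2 <= B ^+ 2 * M ^+ 2 * (p.+1`!)%:R / K%:R ^+ p.
  apply: (@le_trans _ _ (\sum_(N.+1 <= j < K.+1) (B * M * expR (- K%:R)) ^+ 2)).
    apply: ler_sum_nat => j /andP[Nj jK].
    rewrite -(real_normK (num_real (s j))) lerXn2r ?nnegrE //.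
      by rewrite !mulr_ge0 ?expR_ge0 ?(ltW M0) // (le_trans _ extrapolation_constant_ge34).
    by apply: coefficient_small => //; rewrite (leq_ltn_trans _ Nj).
  rewrite sumr_const_nat subSS; set b := (_ ^+ 2); have b0 : 0 <= b by exact: sqr_ge0.
  apply: (@le_trans _ _ (b * K%:R)).
    by rewrite -[leLHS]mulr_natr ler_wpM2l // ler_nat leq_subr.
  rewrite ler_pdivlMr //.
  have -> : b * K%:R * K%:R ^+ p = B ^+ 2 * M ^+ 2 * (expR (- K%:R) ^+ 2 * K%:R ^+ p.+1).
    by rewrite /b [K%:R ^+ p.+1]exprS; move: B (K%:R ^+ p) (expR _) => b' kp' E; ring.
  apply: ler_wpM2l; first by apply: mulr_ge0; exact: sqr_ge0.
  have h := @exprn_le_fact_expR R K%:R p.+1 (ler0n _ _).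
  apply: (le_trans (ler_wpM2l (sqr_ge0 (expR (- K%:R))) h)).
  rewrite mulrCA expr2 -mulrA -expRD addNr expR0 mulr1 ler_piMr //.
have f1 : 1 <= (p.+1`!)%:R :> R by rewrite ler1n fact_gt0.
have Mp : 0 <= M ^+ 2 / K%:R ^+ p by rewrite divr_ge0 ?sqr_ge0 // ltW.
have := ler_wpM2r Mp f1.
have -> : B ^+ 2 * M ^+ 2 * (p.+1`!)%:R / K%:R ^+ p = B ^+ 2 * ((p.+1`!)%:R * (M ^+ 2 / K%:R ^+ p)) by ring.
have -> : 8 * M ^+ 2 / K%:R ^+ p = 8 * (M ^+ 2 / K%:R ^+ p) by rewrite mulrA.
have -> : (2 * B ^+ 2 + 8) * (p.+1`!)%:R * M ^+ 2 / K%:R ^+ p =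
   (2 * B ^+ 2 + 8) * ((p.+1`!)%:R * (M ^+ 2 / K%:R ^+ p)) by ring.
move: (\sum_(_ <= _ < _) _) (M ^+ 2 / _) (_ * (M ^+ 2 / _)) (B ^+ 2) => S q r b; lra.
Qed.


(** When [eps] is 0 the condition eps <= exp(-K^3) holds for every K, so K may tend to infinity and
    the remainder disappears. *)
Lemma energy_le_eps0 : eps = 0 -> A <= 2 * partial N.
Proof.
move=> e0; apply/ler_addgt0Pr => eta eta0.
pose C : R := (2 * B ^+ 2 + 8) * (p.+1`!)%:R * M ^+ 2.
have C0 : 0 <= C.
  by apply: mulr_ge0; rewrite ?sqr_ge0 //; apply: mulr_ge0 => //; have := sqr_ge0 B; lra.
pose K := maxn N (Num.truncn (C / eta)).+1.
have NK : (N <= K)%N by exact: leq_maxl.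
have CK : C / eta <= K%:R.
  by apply: (le_trans (ltW (truncnS_gt _))); rewrite ler_nat leq_maxr.
have K1 : 1 <= K%:R :> R by rewrite ler1n (leq_trans N0).
have Kp : K%:R <= K%:R ^+ p :> R by rewrite -[leLHS]expr1 ler_weXn2l.
apply: (le_trans (energy_le_low_frequencies NK _)); first by rewrite e0 expR_ge0.
rewrite lerD2l -/C ler_pdivrMr ?(lt_le_trans _ (le_trans K1 Kp)) //.
rewrite mulrC -ler_pdivrMr //; exact: le_trans Kp.
Qed.

(** Put N = x^8 and E = y^9. The hypothesis x^8 < x^5 y gives x^3 < y, hence y >= 1, and the cube is
    x^15 y^3 <= y^5 y^3 = y^8 <= y^9. *)
Lemma scale_cube_le (E : R) : 0 < E -> N%:R < N%:R `^ (5 / 8) * E `^ (1 / 9) ->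
  (N%:R `^ (5 / 8) * E `^ (1 / 9)) ^+ 3 <= E.
Proof.
move=> E0; pose x : R := N%:R `^ (1 / 8); pose y := E `^ (1 / 9).
have x1 : 1 <= x.
    have -> : 1 = 1 `^ (1 / 8) :> R by rewrite powR1.
    by rewrite /x; apply: ge0_ler_powR; rewrite ?nnegrE ?ler1n //; lra.
have y0 : 0 <= y by exact: powR_ge0.
have Nx : N%:R = x ^+ 8.
  by rewrite /x -powR_mulrn ?powR_ge0 // -powRrM (_ : 1 / 8 * _ = 1) ?powRr1 //; field.
have Nx5 : N%:R `^ (5 / 8) = x ^+ 5.
  by rewrite /x -powR_mulrn ?powR_ge0 // -powRrM; congr (_ `^ _); field.
have Ey : E = y ^+ 9.
  by rewrite /y -powR_mulrn ?powR_ge0 // -powRrM (_ : 1 / 9 * _ = 1) ?powRr1 ?ltW //; field.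
rewrite Nx5 -/y [X in X < _]Nx => h.
have x5 : 0 < x ^+ 5 by rewrite exprn_gt0 // (lt_le_trans _ x1).
have h3 : x ^+ 3 <= y.
  by rewrite ltW // -(ltr_pM2l x5) -exprD.
have y1 : 1 <= y by apply: le_trans h3; rewrite exprn_ege1.
rewrite [leRHS]Ey exprMn -exprM.
have -> : x ^+ (5 * 3) = (x ^+ 3) ^+ 5 by rewrite -exprM.
apply: (@le_trans _ _ (y ^+ 5 * y ^+ 3)).
  rewrite ler_wpM2r ?exprn_ge0 // lerXn2r ?nnegrE ?exprn_ge0 // (le_trans _ x1) //.
by rewrite -exprD ler_weXn2l.
Qed.

Lemma energy_estimate (C : R) : C = 2 * B ^+ 2 + 8 -> eps < 1 ->
  A <= C * (partial N +
          if eps == 0 then 0 else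
            M ^+ 2 /
            ((N%:R `^ (5 / 8) * `|ln eps| `^ (1 / 9)
              / (6 * n%:R - 3) ^+ 3) ^+ (2 * n - 1)%N)).
Proof.
move=> CE e1; have B2 := sqr_ge0 B; have C8 : 8 <= C by rewrite CE; lra.
have S0 : 0 <= partial N by apply: sumr_ge0 => j _; exact: sqr_ge0.
have SC : 2 * partial N <= C * partial N by rewrite ler_wpM2r //; lra.
have [e0|e0] := eqVneq eps 0; first by rewrite addr0; exact: le_trans (energy_le_eps0 e0) SC.
have ep : 0 < eps by rewrite lt_neqAle eq_sym e0.
set E := `|ln eps|; have lnE : ln eps = - E.
  by rewrite /E ltr0_norm ?opprK // ln_lt0 // ep.
have E0 : 0 < E by rewrite normr_gt0 lt_eqF // ln_lt0 // ep.
have epsE : eps = expR (- E) by rewrite -lnE lnK.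
have -> : 6 * n%:R - 3 = 3 * p%:R :> R.
  by rewrite /p natrB ?muln_gt0 // natrM; ring.
set X := N%:R `^ _ * _; set Dn := (3 * p%:R) ^+ 3.
have Np : 0 < N%:R :> R by rewrite ltr0n.
have X0 : 0 < X by rewrite mulr_gt0 ?powR_gt0.
have Xp : 0 < X ^+ p by rewrite exprn_gt0.
have D1 : 1 <= Dn.
  have p1 : 1 <= p%:R :> R by rewrite ler1n.
  by rewrite /Dn exprn_ege1 //; lra.
have -> : M ^+ 2 / (X / Dn) ^+ p = M ^+ 2 * (Dn ^+ p / X ^+ p).
  by rewrite expr_div_n invf_div.
rewrite mulrDr; have M2 := sqr_ge0 M.
(* For X <= N the tail beyond N suffices: N^(-p) <= X^(-p), and Dn >= 1 only enlarges the bound. *)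
have [XN|NX] := leP X N%:R.
  apply: (le_trans (energy_le_partial_sum N0)); apply: lerD => //.
  rewrite -mulrA; apply: ler_pM; [exact: ler0n|by apply: divr_ge0 => //; exact: exprn_ge0|exact: C8|].
  rewrite ler_wpM2l //; apply: (@le_trans _ _ (X ^+ p)^-1).
    rewrite lef_pV2 ?posrE //; last exact: exprn_gt0.
    by apply: lerXn2r => //; rewrite nnegrE ltW.
  by apply: ler_peMl; [rewrite invr_ge0 ltW|exact: exprn_ege1].
pose K := Num.truncn X.
have /andP[KX XK] : K%:R <= X < K.+1%:R by apply: truncn_itv; exact: ltW.
have NK : (N <= K)%N by rewrite -ltnS -(ltr_nat R); exact: lt_trans XK.
have K1 : 1 <= K%:R :> R by rewrite ler1n (leq_trans N0).
have eK : eps <= expR (- K%:R ^+ 3).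
  rewrite epsE ler_expR lerN2; apply: le_trans (scale_cube_le E0 NX).
  by rewrite lerXn2r ?nnegrE // ltW.
apply: (le_trans (energy_le_low_frequencies NK eK)); apply: lerD => //.
rewrite -CE; move: (M ^+ 2) M2 => m m0; rewrite -!mulrA.
apply: ler_wpM2l; first exact: le_trans C8.
rewrite mulrCA; apply: ler_wpM2l => //.
(* Since X < K + 1 <= 2 K, passing from K to X costs 2^p; together with (p + 1)! this is absorbed by
   Dn^p. *)
have X2 : X <= 2 * K%:R by rewrite ltW // (lt_le_trans XK) // -natr1; lra.
apply: (@le_trans _ _ ((p.+1`!)%:R * (2 ^+ p / X ^+ p))).
  rewrite ler_wpM2l // ler_pdivlMr // mulrC ler_pdivrMr ?exprn_gt0 ?(lt_le_trans _ K1) //.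
  rewrite -exprMn; apply: lerXn2r; rewrite ?nnegrE; [exact: ltW|exact: mulr_ge0|exact: X2].
rewrite mulrA ler_wpM2r ?invr_ge0 ?(ltW Xp) // mulrC.
exact: factor_absorbs_factorial.
Qed.

End Bounds.
End SineCoefficients.

(** * Mean field and Parseval's inequality for two sources *)

Section RadiatedField.
Context {R : realType}.
Local Notation mu := (@lebesgue_measure R).
Local Notation D := (`]0, 1[%classic : set R).
Local Notation "'Int' f" := (\int[mu]_(x in `]0, 1[) f x) (at level 10, f at level 8).
Implicit Types (f g : R -> R) (kappa x y : R).

Let mD := @measurable_unit_itv R.
Let muD := @measure_unit_itv R.

Lemma Re_green kappa y : 0 < kappa -> 0 < y ->
  complex.Re (green kappa 0 y) = sin (kappa * y) / (2 * kappa).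
Proof.
move=> k0 y0; rewrite /green /expi sub0r normrN (gtr0_norm y0).
have -> : 2 * 'i%C * (kappa%:C)%C = Complex 0 (2 * kappa) :> R[i].
  have -> : (2 : R[i]) = Complex 2 0 by rewrite -[LHS](rmorph_nat (real_complex R)).
  by simpc.
have c0 : 2 * kappa != 0 by rewrite mulf_neq0 ?gt_eqF.
have -> : (Complex 0 (2 * kappa))^-1 = Complex 0 (- (2 * kappa)^-1).
  apply: (mulrI (_ : Complex 0 (2 * kappa) \is a GRing.unit)).
    by rewrite unitfE eq_complex /= negb_and c0 orbT.
  rewrite mulrV; last by rewrite unitfE eq_complex /= negb_and c0 orbT.
  by rewrite -[1]/(Complex 1 0); simpc; rewrite mulfV.
by simpc.
Qed.

Lemma radiated_mean (d : measure_display) (T : measurableType d)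
    (P : probability T R) (W : R -> T -> R) f sigma u kappa :
  brownian_motion P W -> L2 mu D f -> radiated_field P W f sigma u -> 0 < kappa ->
  complex.Re (cexpectation P (u 0 kappa)) = sine_transform f kappa / (2 * kappa).
Proof.
move=> BW Lf ru k0.
have [|I [[ReI _] uE]] := ru 0 kappa _ k0; first by rewrite in_itv /= lexx ler01.
have [iI mI] := ito_integral_mean BW ReI.
rewrite /cexpectation unlock /=.
have e w : complex.Re (u 0 kappa w) = sine_transform f kappa / (2 * kappa) + complex.Re (I w).
  have ReD (g : R -> R[i]) (z : R[i]) : complex.Re (cintegral g + z) =
      Int (fun y => complex.Re (g y)) + complex.Re z by case: z.
  rewrite uE ReD; congr (_ + _).
  rewrite [RHS]mulrC /sine_transform -RintegralZl //; last first.
    apply: (@L2M _ _ _ mu D mD _ _ Lf).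
    by apply: (@continuous_L2 _ _ 1 (@continuous_sinl _ kappa)) => x; exact: sin_max.
  apply: eq_Rintegral => y yD.
  have /andP[y0 _] : 0 < y < 1 by move: yD; rewrite inE /= in_itv.
  have ReZ (z : R[i]) (r : R) : complex.Re (z * (r%:C)%C) = complex.Re z * r.
    by case: z => z1 z2 /=; rewrite mulr0 subr0.
  by rewrite ReZ Re_green //; ring.
under eq_integral do rewrite e.
rewrite -/(Rintegral P setT (fun w => sine_transform f kappa / (2 * kappa) + complex.Re (I w))).
have P1 : P [set: T] = 1%E by exact: probability_setT.
have ic : P.-integrable [set: T] (EFin \o (fun=> sine_transform f kappa / (2 * kappa))).
  by apply: finite_measure_integrable_cst.
by rewrite RintegralD // mI addr0 Rintegral_cst // [fine _](congr1 fine P1) mulr1.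
Qed.

(** The difference vanishes near the endpoints only almost everywhere, whereas [parseval_le] asks
    for vanishing at every point; it is therefore multiplied by the indicator of [e, 1 - e], which
    changes no integral. *)
Lemma sources_parseval n1 n2 M1 M2 f1 f2 (eta : R) :
  source_class n1 M1 f1 -> source_class n2 M2 f2 -> 0 < eta ->
  exists K0, forall K, (K0 <= K)%N -> L2norm (fun y => f1 y - f2 y) ^+ 2 <=
    eta + 2 * \sum_(j < K) (sine_transform f1 (j%:R * pi) - sine_transform f2 (j%:R * pi)) ^+ 2.
Proof.
move=> s1 s2 eta0; pose f y := f1 y - f2 y.
have Lf1 : L2 mu D f1 by case: s1 => -[].
have Lf2 : L2 mu D f2 by case: s2 => -[].
have Lf : L2 mu D f by exact: (@L2B _ _ _ mu D mD _ _ Lf1 Lf2).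
have [e1 e10 a1] := source_vanishes_near_boundary s1.
have [e2 e20 a2] := source_vanishes_near_boundary s2.
pose e := Num.min e1 e2; have e0 : 0 < e by rewrite lt_min e10.
pose h y : R := \1_(`[e, 1 - e]%classic : set R) y.
pose f' y := f y * h y.
have mh : measurable_fun D h by exact: measurable_indic.
have Lf' : L2 mu D f'.
  apply: (@L2_mulr _ _ _ mu D mD _ _ 1 Lf mh) => x _.
  by rewrite /h indicE; case: (x \in _); rewrite ?normr1 ?normr0.
have f'0 x : ~~ (e <= x <= 1 - e) -> f' x = 0.
  by move=> xI; rewrite /f' /h indicE memNset ?mulr0 //= in_itv /=; exact/negP.
have ff' : {ae mu, forall y, y \in `]0, 1[ -> f' y = f y}.
  apply: (@filterS2 _ _ (ae_filter_ringOfSetsType mu) _ _ _ _ a1 a2) => y h1 h2 yI.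
  have [h3|h3] := boolP (e <= y <= 1 - e).
    by rewrite /f' /h indicE mem_set ?mulr1.
  have l1 : e <= e1 by rewrite ge_min lexx.
  have l2 : e <= e2 by rewrite ge_min lexx orbT.
  rewrite f'0 // /f h1 ?h2 ?subrr //; apply: contra h3 => /andP[p q]; apply/andP; split; lra.
have eqI g : measurable_fun D g -> Int (fun y => f' y * g y) = Int (fun y => f y * g y).
  move=> mg; congr fine; apply: ae_eq_integral => //.
  - by apply/measurable_EFinP/measurable_funM => //; case: Lf'.
  - by apply/measurable_EFinP/measurable_funM => //; case: Lf.
  - by apply: (@filterS _ _ (ae_filter_ringOfSetsType mu) _ _ _ ff') => y h1 Dy; rewrite /= h1.
have [K0 HK] := parseval_le Lf' e0 f'0 eta0.
exists K0 => K k0; have := HK K k0.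
have -> : Int (fun x => f' x ^+ 2) = L2norm f ^+ 2.
  rewrite /L2norm sqr_sqrtr; last by apply: Rintegral_ge0 => x _; exact: sqr_ge0.
  under eq_Rintegral do rewrite expr2.
  (* The square is exchanged one factor at a time, [eqI] being linear in the modified function. *)
  rewrite eqI; last by case: Lf'.
  under eq_Rintegral do rewrite mulrC.
  rewrite eqI; last by case: Lf.
  by apply: eq_Rintegral => y _; rewrite expr2.
move=> /le_trans; apply; rewrite lerD2l ler_wpM2l // le_eqVlt; apply/orP; left; apply/eqP.
apply: eq_bigr => j _; congr (_ ^+ 2).
have Lj := L2_sinpi (R := R) j.
rewrite eqI; last by case: Lj.
rewrite /sine_transform -RintegralB //.
- by apply: eq_Rintegral => y _; rewrite /f /sinpi mulrBl.
- exact: (@L2M _ _ _ mu D mD _ _ Lf1 Lj).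
- exact: (@L2M _ _ _ mu D mD _ _ Lf2 Lj).
Qed.


(** The uniform bound [b] is essential: [sup] of an unbounded set is a default value and would
    dominate nothing. Nonnegativity is read off at kappa = 1/2. *)
Lemma eps4_sup_le (S : R -> R) (v : R -> R -> R[i]) (b : R) :
  (forall kappa, 0 < kappa -> 2 * kappa * `|complex.Re (v 0 kappa)| = `|S kappa|) ->
  (forall kappa, 0 < kappa < 1 -> `|S kappa| <= b) ->
  0 <= eps4 v /\ forall kappa, 0 < kappa < 1 -> `|S kappa| <= eps4 v.
Proof.
move=> vS Sb.
have le kappa : 0 < kappa < 1 -> `|S kappa| <= eps4 v.
  move=> /andP[k0 k1]; apply: ub_le_sup.
    exists b => _ [k /= + <-]; rewrite in_itv /= => /andP[q0 q1].
    by rewrite vS // Sb ?q0.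
  by exists kappa; rewrite /= ?in_itv /= ?k0 // vS.
split => //; apply: le_trans (le (1 / 2) _); first exact: normr_ge0.
by apply/andP; split; lra.
Qed.

End RadiatedField.

Theorem theorem2p3 (R : realType) :
  exists C3 : R, 0 < C3 /\
  forall (d : measure_display) (T : measurableType d) (P : probability T R)
    (W : R -> T -> R) (n N : nat) (M : R) (f1 f2 sigma1 sigma2 : R -> R)
    (u1 u2 : R -> R -> T -> R[i]) (v : R -> R -> R[i]),
    measure_is_complete P ->
    brownian_motion P W ->
    (1 <= n)%N -> (1 <= N)%N -> 1 < M ->
    source_class n M f1 -> source_class n M f2 ->
    sq_integrable sigma1 -> sq_integrable sigma2 ->
    radiated_field P W f1 sigma1 u1 ->
    radiated_field P W f2 sigma2 u2 ->
    (forall x kappa, v x kappa =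
       cexpectation P (u1 x kappa) - cexpectation P (u2 x kappa)) ->
    eps4 v < 1 ->
    L2norm (fun y => f1 y - f2 y) ^+ 2 <=
    C3 * (eps3 v N ^+ 2 +
          if eps4 v == 0 then 0 else
            M ^+ 2 /
            ((N%:R `^ (5 / 8) * `|ln (eps4 v)| `^ (1 / 9)
              / (6 * n%:R - 3) ^+ 3) ^+ (2 * n - 1)%N)).
Proof.
exists (2 * @extrapolation_constant R ^+ 2 + 8); split.
  by have := sqr_ge0 (@extrapolation_constant R); lra.
move=> d T P W n N M f1 f2 sigma1 sigma2 u1 u2 v _ BW n0 N0 M1 s1 s2 _ _ r1 r2 vE e1.
have M0 : 0 <= M by rewrite ltW // (lt_trans ltr01).
have Lf1 : L2 lebesgue_measure `]0, 1[%classic f1 by case: s1 => -[].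
have Lf2 : L2 lebesgue_measure `]0, 1[%classic f2 by case: s2 => -[].
pose S kappa := sine_transform f1 kappa - sine_transform f2 kappa.
have vS kappa : 0 < kappa -> 2 * kappa * `|complex.Re (v 0 kappa)| = `|S kappa|.
  move=> k0; have ReB (z w : R[i]) : complex.Re (z - w) = complex.Re z - complex.Re w.
    by case: z w => ? ? [].
  rewrite vE ReB (radiated_mean BW Lf1 r1 k0) (radiated_mean BW Lf2 r2 k0) -mulrBl -/(S kappa).
  have k2 : 0 < 2 * kappa by rewrite mulr_gt0.
  by rewrite normrM (gtr0_norm (_ : 0 < (2 * kappa)^-1)) ?invr_gt0 // mulrCA mulfV ?mulr1 // gt_eqF.
have Sbound kappa : `|S kappa| <= M + M.
  apply: (le_trans (ler_normB _ _)); apply: lerD.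
    have := @source_pairing R n M f1 0 _ 1 M0 s1 (leq0n n) (smooth_sin_affine kappa 0) (fun _ _ => sin_max _).
    rewrite mulr1; congr (`|_| <= _); apply: eq_Rintegral => y _.
    by rewrite derive1n0 addr0.
  have := @source_pairing R n M f2 0 _ 1 M0 s2 (leq0n n) (smooth_sin_affine kappa 0) (fun _ _ => sin_max _).
  rewrite mulr1; congr (`|_| <= _); apply: eq_Rintegral => y _.
  by rewrite derive1n0 addr0.
have [e0 Se] := eps4_sup_le vS (fun kappa _ => Sbound kappa).
pose s j := S (j%:R * pi).
have e3 : eps3 v N ^+ 2 = \sum_(1 <= j < N.+1) s j ^+ 2.
  rewrite /eps3 sqr_sqrtr; last first.
    by apply: sumr_ge0 => j _; rewrite -exprMn sqr_ge0.
  apply: eq_big_nat => j /andP[j0 _]; have jp : 0 < j%:R * pi :> R by rewrite mulr_gt0 ?ltr0n ?pi_gt0.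
  by rewrite -exprMn -mulrA vS // real_normK ?num_real.
rewrite e3; apply: (@energy_estimate R s n N M _ (eps4 v)) => //.
- move=> eta eta0; exact: sources_parseval s1 s2 eta0.
- by rewrite /s /S /sine_transform mul0r; under eq_Rintegral do rewrite mul0r sin0 mulr0;
    under [X in _ - X]eq_Rintegral do rewrite mul0r sin0 mulr0; rewrite subrr.
- move=> j j0; apply: (le_trans (ler_normB _ _)).
  have := lerD (source_sine_decay M0 s1 j0) (source_sine_decay M0 s2 j0).
  by move=> /le_trans; apply; rewrite -mulrA mulrDl mul1r.
- move=> K j /andP[j0 jK]; have K0 : (0 < K)%N by exact: leq_trans jK.
  (* pi <= 4 and j <= K place the frequency j pi in the range kappa <= 4 K of the extrapolation. *)
  have pi4 : pi <= 4 :> R by have := pihalf_lt2 R; lra.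
  have j1 : 1 <= j%:R :> R by rewrite ler1n.
  have jpi : 1 <= j%:R * pi :> R by have := pi_ge2 R; nra.
  have jpK : j%:R * pi <= 4 * K%:R :> R.
    by rewrite mulrC; apply: ler_pM => //; [exact: pi_ge0|rewrite ler_nat].
  have [m [w [t [t01 wsum ext]]]] := sin_extrapolation K0 jpi jpK.
  have x1 := source_extrapolation M0 s1 ext; have x2 := source_extrapolation M0 s2 ext.
  (* Two extrapolation errors, each at most 17 M exp(-K), plus the extrapolated value, which only
     involves S at nodes in (0,1) and is thus at most the total weight times eps4. *)
  have -> : s j = (sine_transform f1 (j%:R * pi) - \sum_(i < m) w i * sine_transform f1 (t i)) -
     (sine_transform f2 (j%:R * pi) - \sum_(i < m) w i * sine_transform f2 (t i)) +
     \sum_(i < m) w i * S (t i).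
    have -> : \sum_(i < m) w i * S (t i) = \sum_(i < m) w i * sine_transform f1 (t i) -
       \sum_(i < m) w i * sine_transform f2 (t i).
      by rewrite -sumrB; apply: eq_bigr => i _; rewrite mulrBr.
    by rewrite /s /S; ring.
  apply: (le_trans (ler_normD _ _)); rewrite addrC; apply: lerD.
    apply: (le_trans (ler_norm_sum _ _ _)).
    apply: (@le_trans _ _ ((\sum_(i < m) `|w i|) * eps4 v)); last by rewrite ler_wpM2r.
    by rewrite mulr_suml; apply: ler_sum => i _; rewrite normrM ler_wpM2l // Se.
  apply: (le_trans (ler_normB _ _)); have := lerD x1 x2; move=> /le_trans; apply.
  by rewrite -!mulrA le_eqVlt; apply/orP; left; apply/eqP; ring.
Qed.
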